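(* Let $\alpha=[1,a,a+1,\ldots,a+2t-3,b]\in P(X)$ be a Pfaffian of size $2t$. Then the initial ideal $\operatorname{in}(I_\alpha(X))$ with respect to an anti-diagonal term order is generated by: (i) all of the indeterminates in the first $a-1$ rows and columns, i.e. in region $A$; (ii) all of the $2$-adiags in the first $a-1$ rows, i.e. with all indeterminates in region $A\cup B\cup C$; (iii) all of the $t$-adiags in the first $b-1$ rows and columns, i.e. with all indeterminates in region $A\cup B\cup D$; (iv) all of the $(t+1)$-adiags.
   Context: Let $K$ be a field, $X=(X_{ij})$ a skew-symmetric $n\times n$ matrix of indeterminates, and $R=K[X]=K[X_{ij}: 1\le i<j\le n]$. For $1\le a_1<\dots<a_{2t}\le n$, $[a_1,\ldots,a_{2t}]$ denotes the Pfaffian of the skew-symmetric submatrix of $X$ with row and column indices $a_1,\ldots,a_{2t}$; it has size $2t$. $P(X)$ is the set of all Pfaffians of $X$, partially ordered by: $[a_1,\ldots,a_{2t}]\le[b_1,\ldots,b_{2s}]$ iff $t\ge s$ and $a_i\le b_i$ for $i=1,\ldots,2s$. The ideal cogenerated by $\alpha\in P(X)$ is $I_\alpha(X)=(\beta\in P(X): \beta\not\ge\alpha)\subset R$. A term order on $R$ is anti-diagonal if the initial monomial of every Pfaffian $[a_1,\ldots,a_{2t}]$ is $X_{a_1a_{2t}}X_{a_2a_{2t-1}}\cdots X_{a_ta_{t+1}}$; an arbitrary anti-diagonal term order is fixed. For $s\ge1$, an $s$-adiag is a monomial $X_{i_1j_1}\cdots X_{i_sj_s}$ with $i_1<i_2<\dots<i_s<j_s<j_{s-1}<\dots<j_1$.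 Here $t\ge 2$, $a\ge 2$ and $a+2t-3<b\le n$. Let $X_+=\{(i,j):1\le i<j\le n\}$; the indeterminate $X_{ij}$ ($i<j$) is identified with $(i,j)$. The regions of $X_+$ are $A=\{(i,j): j\le a-1\}$, $B=\{(i,j): i\le a-1,\ a\le j\le b-1\}$, $C=\{(i,j): i\le a-1,\ j\ge b\}$, $D=\{(i,j): i\ge a,\ j\le b-1\}$ (all with $1\le i<j\le n$). *)

(* Defs.v *)
From HB Require Import structures.
From mathcomp Require Import all_boot all_order all_fingroup all_algebra.
From mathcomp Require Import mpoly.

Set Implicit Arguments.
Unset Strict Implicit.
Unset Printing Implicit Defensive.

Import GRing.Theory.
Local Open Scope ring_scope.

(* Rows and columns are ordinals counted from 0, whereas the mathematics counts
   them from 1; [lab] is the translation. *)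
Definition lab n (i : 'I_n) : nat := i.+1.

Section Pfaffian.
Variables (R : comNzRingType) (t : nat).

Lemma ord_even_subproof (i : 'I_t) : (i.*2 < t.*2)%N.
Proof. by rewrite ltn_double. Qed.

Lemma ord_odd_subproof (i : 'I_t) : (i.*2.+1 < t.*2)%N.
Proof. by rewrite -doubleS ltn_Sdouble ltn_ord. Qed.

Definition ord_even (i : 'I_t) : 'I_t.*2 := Ordinal (ord_even_subproof i).
Definition ord_odd (i : 'I_t) : 'I_t.*2 := Ordinal (ord_odd_subproof i).

(* Each perfect matching of 'I_t.*2 is encoded by exactly one such s: its edges
   are {s (2i), s (2i+1)}, smaller end first, sorted by their smaller ends. *)
Definition matching_perm (s : 'S_t.*2) : bool :=
  [forall i, s (ord_even i) < s (ord_odd i)]%N &&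
  [forall i : 'I_t, forall j : 'I_t,
     (i < j)%N ==> (s (ord_even i) < s (ord_even j))%N].

Definition pfaffian (M : 'M[R]_t.*2) : R :=
  \sum_(s : 'S_t.*2 | matching_perm s)
     (-1) ^+ s * \prod_(i < t) M (s (ord_even i)) (s (ord_odd i)).

End Pfaffian.

Definition upos n := {p : 'I_n * 'I_n | (p.1 < p.2)%N}.

(* The number n(n-1)/2 of indeterminates; X_ij is the indeterminate whose index
   is the rank of (i, j) in the enumeration of [upos n]. *)
Definition nvar n : nat := #|{: upos n}|.

(* The exponent of X_ij; the value for j <= i is never used. *)
Definition xmon n (i j : 'I_n) : 'X_{1..nvar n} :=
  if (insub (i, j) : option (upos n)) is Some p then U_(enum_rank p)%MM
  else 0%MM.

Definition genX (K : fieldType) n : 'M[{mpoly K[nvar n]}]_n :=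
  \matrix_(i, j) if (i < j)%N then 'X_[xmon i j]
                 else if (j < i)%N then - 'X_[xmon j i] else 0.

(* P(X), by row indices. The empty Pfaffian 1 (half_size = 0) is included; it is
   the largest element, so it never generates a cogenerated ideal. *)
Record pfidx n := PfIdx {
  half_size : nat;
  pfrows : half_size.*2.-tuple 'I_n;
  pfrows_sorted : sorted ltn [seq lab i | i <- pfrows]
}.

Definition pflabels n (u : pfidx n) : seq nat := [seq lab i | i <- pfrows u].

Definition pfpoly (K : fieldType) n (u : pfidx n) : {mpoly K[nvar n]} :=
  pfaffian (mxsub (tnth (pfrows u)) (tnth (pfrows u)) (genX K n)).

Definition pfle n (u v : pfidx n) : Prop :=
  (half_size v <= half_size u)%N /\
  forall k, (k < (half_size v).*2)%N ->
    (nth 0 (pflabels u) k <= nth 0 (pflabels v) k)%N.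

Definition ideal_gen (R : comNzRingType) (S : R -> Prop) (f : R) : Prop :=
  exists (m : nat) (c g : 'I_m -> R),
    (forall k, S (g k)) /\ f = \sum_(k < m) c k * g k.

Definition cogen_ideal (K : fieldType) n (alpha : pfidx n) :
    {mpoly K[nvar n]} -> Prop :=
  ideal_gen (fun g => exists2 beta : pfidx n,
                        ~ pfle alpha beta & g = pfpoly K beta).

Record term_order N (le : rel 'X_{1..N}) : Prop := TermOrder {
  to_total : total le;
  to_anti : antisymmetric le;
  to_trans : transitive le;
  to_ge1 : forall m, le 0%MM m;
  to_mul : forall m1 m2 m, le m1 m2 -> le (m1 + m)%MM (m2 + m)%MM
}.

Definition is_initial (K : fieldType) N (le : rel 'X_{1..N})
    (f : {mpoly K[N]}) (m : 'X_{1..N}) : Prop :=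
  m \in msupp f /\ forall m', m' \in msupp f -> le m' m.

Definition initial_ideal (K : fieldType) N (le : rel 'X_{1..N})
    (I : {mpoly K[N]} -> Prop) : {mpoly K[N]} -> Prop :=
  ideal_gen (fun g => exists (f : {mpoly K[N]}) (m : 'X_{1..N}),
                        [/\ I f, is_initial le f m & g = 'X_[m]]).

Lemma ord_low_subproof t (k : 'I_t) : (k < t.*2)%N.
Proof. by rewrite -addnn ltn_addr. Qed.

Definition ord_low t (k : 'I_t) : 'I_t.*2 := Ordinal (ord_low_subproof k).

Definition antidiag_mon n (u : pfidx n) : 'X_{1..nvar n} :=
  (\sum_(k < half_size u)
     xmon (tnth (pfrows u) (ord_low k))
          (tnth (pfrows u) (rev_ord (ord_low k))))%MM.

Definition antidiagonal (K : fieldType) n (le : rel 'X_{1..nvar n}) : Prop :=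
  forall u : pfidx n, is_initial le (pfpoly K u) (antidiag_mon u).

Definition adiag n (s : nat) (reg : pred ('I_n * 'I_n)) (m : 'X_{1..nvar n}) :
    Prop :=
  exists i j : s.-tuple 'I_n,
    [/\ sorted ltn [seq lab k | k <- i ++ rev j],
        forall k, reg (tnth i k, tnth j k)
      & m = (\sum_(k < s) xmon (tnth i k) (tnth j k))%MM].

Definition regA n (a : nat) : pred ('I_n * 'I_n) :=
  fun p => (lab p.2 <= a - 1)%N.
Definition regB n (a b : nat) : pred ('I_n * 'I_n) :=
  fun p => [&& lab p.1 <= a - 1, a <= lab p.2 & lab p.2 <= b - 1]%N.
Definition regC n (a b : nat) : pred ('I_n * 'I_n) :=
  fun p => (lab p.1 <= a - 1)%N && (b <= lab p.2)%N.
Definition regD n (a b : nat) : pred ('I_n * 'I_n) :=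
  fun p => (a <= lab p.1)%N && (lab p.2 <= b - 1)%N.

(* Main.v *)
(* The inclusion of the monomial ideal J in the initial ideal holds because the
   adiags in J are the leading monomials of Pfaffians that are not >= alpha.

   For the converse, an element of I_alpha whose leading monomial is not in J can
   be reduced to a nonzero element f of I_alpha supported outside J. The
   substitution
     X_ij |-> c_i c_j sum_(k < t) (v^k_(r i) w^k_(r j) - v^k_(r j) w^k_(r i))
   kills I_alpha, where r collapses the indices below a to a single one, c_i is
   a new variable for i < a and 1 otherwise, and w^k is truncated to the columns
   >= b in the last summand: a sum of s alternating forms of rank 2 has vanishing
   Pfaffians of size > 2s.

   It remains to see that f is not killed. View a monomial as a multiset of arcs
   (i, j), ordered by nesting. By Mirsky's theorem, a monomial m outside J splits
   into t antichains, one for each summand: an arc goes to the summand given by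
   its height, and condition (iii) says that the arcs of maximal height end at or
   beyond b. Choosing in each summand the term v_i w_j with i < j gives a monomial
   M(m) in the image of m. If M(m) also occurs in the image of another monomial m',
   then m' is obtained from m by re-pairing row and column indices within the
   summands (and, for the indices below a, by re-pairing with the columns). Since
   the pairing in m is sorted, the rearrangement inequality shows that m maximizes
   (sum of (r i)(r j), sum of i j over i < a) strictly in lexicographic order.
   Hence M(m) survives for the monomial m of f that minimizes this pair. *)
From HB Require Import structures.
Require Import Defs.
From mathcomp Require Import all_boot all_order all_fingroup all_algebra.
From mathcomp Require Import mpoly.
From mathcomp Require Import zify ring.
From Stdlib Require Import Classical.

Set Implicit Arguments.
Unset Strict Implicit.
Unset Printing Implicit Defensive.

Import GRing.Theory.
Local Open Scope ring_scope.

(** * Pfaffians of non-injective and of low rank forms *)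

(** Deleting i from the source and j from the target turns a permutation with s i = j into one on N
    letters. Used twice, this strips the edge containing 0 from a matching. *)
Lemma reindex_lift_perm (V : nmodType) N (i j : 'I_N.+1)
    (P : pred 'S_N.+1) (F : 'S_N.+1 -> V) :
  \sum_(s | P s && (s i == j)) F s =
    \sum_(s | P (lift_perm i j s)) F (lift_perm i j s).
Proof.
have lift_surj (s : 'S_N.+1) : s i = j -> {s' | s = lift_perm i j s'}.
  move=> sij.
  have ne k : j != s (lift i k) by rewrite -sij (inj_eq perm_inj) neq_lift.
  pose g k := sval (unlift_some (ne k)).
  have gE k : lift j (g k) = s (lift i k).
    by rewrite /g; case: (unlift_some _) => k' /= -> _.
  have g_inj : injective g.
    by move=> k k' /(congr1 (lift j)); rewrite !gE => /perm_inj/lift_inj.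
  exists (perm g_inj); apply/permP=> k; case: (unliftP i k) => [k'|] ->.
    by rewrite lift_perm_lift permE gE.
  by rewrite lift_perm_id.
pose h s := if eqP is ReflectT e then sval (lift_surj s e) else 1%g.
have hK (s : 'S_N.+1) : s i = j -> lift_perm i j (h s) = s.
  by rewrite /h; case: eqP => // e _; case: (lift_surj s e).
rewrite (reindex_onto (lift_perm i j) h) /=; last by move=> s /andP[_ /eqP/hK].
apply: eq_bigl => s; rewrite lift_perm_id eqxx andbT.
suff -> : h (lift_perm i j s) = s by rewrite eqxx andbT.
have /hK/permP E : lift_perm i j s i = j by rewrite lift_perm_id.
by apply/permP=> k; have := E (lift i k); rewrite !lift_perm_lift => /lift_inj.
Qed.

(** Some edge contains 0, necessarily as its smaller end, and smaller ends increase along the edges,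
    so it is the first edge. *)
Lemma matching_perm_0 t (s : 'S_t.+1.*2) :
  matching_perm s -> s (ord0 : 'I_t.*2.+2) = ord0.
Proof.
case/andP=> /forallP le_edge /forallP le_edges.
have e0 : ord0 = ord_even ord0 :> 'I_t.+1.*2 by apply: val_inj.
have s0_le i : (s (ord0 : 'I_t.*2.+2) <= s (ord_even i))%N.
  rewrite e0; case: (posnP i) => [i0 | i_gt0].
    by rewrite (_ : i = ord0) //; apply: val_inj.
  have /forallP/(_ i)/implyP/(_ i_gt0)/ltnW := le_edges ord0.
  by [].
set x := (s^-1)%g (ord0 : 'I_t.*2.+2).
suff : (s (ord0 : 'I_t.*2.+2) <= s x)%N.
  by rewrite permKV leqn0 => /eqP E; apply: val_inj.
have half_lt : (x./2 < t.+1)%N by rewrite -ltn_double; have := ltn_ord x; lia.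
pose i := Ordinal half_lt.
case: (boolP (odd x)) => odd_x.
  have -> : x = ord_odd i by apply: val_inj => /=; lia.
  exact: leq_trans (s0_le i) (ltnW (le_edge i)).
have -> : x = ord_even i by apply: val_inj => /=; lia.
exact: s0_le.
Qed.

Lemma ord_even_lift t (i : 'I_t) :
  ord_even (lift ord0 i) = lift ord0 (lift ord0 (ord_even i)) :> 'I_t.*2.+2.
Proof. exact: val_inj. Qed.

Lemma ord_odd_lift t (i : 'I_t) :
  ord_odd (lift ord0 i) = lift ord0 (lift ord0 (ord_odd i)) :> 'I_t.*2.+2.
Proof. exact: val_inj. Qed.

Lemma ltn_lift N (h : 'I_N.+1) (i j : 'I_N) : (lift h i < lift h j)%N = (i < j)%N.
Proof. by rewrite /= /bump; lia. Qed.

(** Lifts preserve order, and the conditions on the new first edge hold automatically because its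
    smaller end is 0. *)
Lemma matching_perm_lift t (j : 'I_t.*2.+1) (s : 'S_t.*2) :
  @matching_perm t.+1 (lift_perm ord0 ord0 (lift_perm ord0 j s)) =
  matching_perm s.
Proof.
set s' : 'S_t.+1.*2 := lift_perm ord0 ord0 _.
have e0 : s' (ord_even ord0) = ord0 :> 'I_t.*2.+2.
  by rewrite (_ : ord_even ord0 = (ord0 : 'I_t.*2.+2)) ?lift_perm_id //; apply: val_inj.
have o0 : s' (ord_odd ord0) = lift ord0 j :> 'I_t.*2.+2.
  rewrite (_ : ord_odd ord0 = lift (ord0 : 'I_t.*2.+2) ord0); last exact: val_inj.
  by rewrite lift_perm_lift lift_perm_id.
have eS i : s' (ord_even (lift ord0 i)) = lift ord0 (lift j (s (ord_even i))).
  by rewrite ord_even_lift !lift_perm_lift.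
have oS i : s' (ord_odd (lift ord0 i)) = lift ord0 (lift j (s (ord_odd i))).
  by rewrite ord_odd_lift !lift_perm_lift.
congr (_ && _).
  apply/forallP/forallP => [H i | H i].
    by have := H (lift ord0 i); rewrite eS oS !ltn_lift.
  by case: (unliftP ord0 i) => [i'|] ->; rewrite ?e0 ?o0 // eS oS !ltn_lift.
apply/forallP/forallP => [H i | H i]; apply/forallP => k.
  by have /forallP/(_ (lift ord0 k)) := H (lift ord0 i); rewrite !eS !ltn_lift.
case: (unliftP ord0 i) => [i'|] ->; case: (unliftP ord0 k) => [k'|] ->.
- by have /forallP/(_ k') := H i'; rewrite !eS !ltn_lift.
- by [].
- by rewrite e0 eS.
- by [].
Qed.

(** Expansion along the first row: j indexes the partner of 0 in the matching, and its parity is the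
    sign contributed by [odd_lift_perm]. *)
Lemma pfaffian_expand (R : comNzRingType) t (M : 'M[R]_t.*2.+2) :
  @pfaffian R t.+1 M =
  \sum_(j < t.*2.+1) (-1) ^+ j * M ord0 (lift ord0 j) *
     @pfaffian R t (mxsub (lift ord0 \o lift j) (lift ord0 \o lift j) M).
Proof.
rewrite {1}/pfaffian.
rewrite (eq_bigl (fun s : 'S_t.*2.+2 => @matching_perm t.+1 s && (s ord0 == ord0))); last first.
  move=> s /=; case: (boolP (@matching_perm t.+1 s)) => // /matching_perm_0 ->.
  by rewrite eqxx.
rewrite reindex_lift_perm.
rewrite (partition_big (fun s : 'S_t.*2.+1 => s ord0) predT) //=.
apply: eq_bigr => j _; rewrite reindex_lift_perm /pfaffian big_distrr /=.
apply: eq_big => [s | s _]; first exact: matching_perm_lift.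
have -> : (-1) ^+ (lift_perm ord0 ord0 (lift_perm ord0 j s) : bool) =
    (-1) ^+ j * (-1) ^+ (s : bool) :> R.
  by rewrite !odd_lift_perm /= signr_addb signr_odd.
rewrite -!mulrA; congr (_ * _); rewrite [RHS]mulrCA; congr (_ * _).
rewrite big_ord_recl; congr (_ * _).
  rewrite (_ : ord_even ord0 = (ord0 : 'I_t.*2.+2)); last exact: val_inj.
  rewrite (_ : ord_odd ord0 = lift (ord0 : 'I_t.*2.+2) ord0); last exact: val_inj.
  by rewrite lift_perm_id lift_perm_lift lift_perm_id.
apply: eq_bigr => i _; rewrite ord_even_lift ord_odd_lift !lift_perm_lift.
by rewrite mxE.
Qed.

Section PfaffianOnSequences.
Variables (R : comNzRingType) (T : Type) (J : T -> T -> R).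

(** Interior product of g with f: the sum over positions j of (-1)^j f(l_j) g(l without l_j), cf.
    [contract_codom]. *)
Fixpoint contract (f : T -> R) (g : seq T -> R) (l : seq T) : R :=
  if l is x :: l' then f x * g l' - contract f (fun m => g (x :: m)) l' else 0.

(* Row expansion for sequences of length 2t; the value at other lengths is 0. *)
Fixpoint pfaffian_seq (t : nat) (l : seq T) : R :=
  if t is t'.+1 then
    if l is x :: l' then contract (J x) (pfaffian_seq t') l' else 0
  else (nilp l)%:R.

Lemma eq_contract f g g' l : g =1 g' -> contract f g l = contract f g' l.
Proof.
elim: l g g' => [|x l IH] g g' eg //=.
by rewrite eg (IH _ (fun m => g' (x :: m))) // => m; rewrite eg.
Qed.

Lemma contract_lin f (c : R) g g' l :
  contract f (fun m => c * g m - g' m) l = c * contract f g l - contract f g' l.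
Proof.
elim: l g g' => [|x l IH] g g' /=; first by ring.
by rewrite (IH (fun m => g (x :: m)) (fun m => g' (x :: m))); ring.
Qed.

Lemma contract_opp f g l : contract f (fun m => - g m) l = - contract f g l.
Proof. by elim: l g => [|x l IH] g /=; rewrite ?oppr0 // IH; ring. Qed.

Lemma contract_zero f g l : g =1 (fun=> 0) -> contract f g l = 0.
Proof.
move=> /eq_contract ->; elim: l => //= x l ->; ring.
Qed.

(** Two entries can be removed in either order, with opposite signs. A separate induction covers
    characteristic 2, where being its own opposite, as [contract_anti] says, does not force a value
    to vanish. *)
Lemma contract_contract f g l : contract f (contract f g) l = 0.
Proof.
elim: l g => [|x l IH] g //=.
by rewrite contract_lin IH; ring.
Qed.

Lemma contract_anti f h g l :
  contract f (contract h g) l = - contract h (contract f g) l.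
Proof.
elim: l g => [|x l IH] g /=; first by rewrite oppr0.
by rewrite !contract_lin IH; ring.
Qed.

Definition adj_anti (g : seq T -> R) : Prop :=
  forall m1 x y m2, g (m1 ++ x :: y :: m2) = - g (m1 ++ y :: x :: m2).

Definition adj_zero (g : seq T -> R) : Prop :=
  forall m1 x m2, g (m1 ++ x :: x :: m2) = 0.

Lemma adj_anti_contract f g : adj_anti g -> adj_anti (contract f g).
Proof.
move=> Hg m1 x y m2; elim: m1 g Hg => [|z m1 IH] g Hg /=.
  rewrite (@eq_contract _ (fun m => g (x :: y :: m))
             (fun m => - g (y :: x :: m))); last by move=> m; exact: (Hg [::]).
  by rewrite contract_opp; ring.
rewrite Hg (IH (fun m => g (z :: m))); first by ring.
by move=> m x' y' m'; exact: (Hg (z :: m)).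
Qed.

Lemma adj_zero_contract f g : adj_zero g -> adj_zero (contract f g).
Proof.
move=> Hg m1 x m2; elim: m1 g Hg => [|z m1 IH] g Hg /=.
  by rewrite contract_zero; [ring | move=> m; exact: (Hg [::])].
rewrite Hg (IH (fun m => g (z :: m))); first by ring.
by move=> m x' m'; exact: (Hg (z :: m)).
Qed.

Hypothesis J_diag : forall x, J x x = 0.
Hypothesis J_skew : forall x y, J x y = - J y x.

(** For a pair at the head, two row expansions produce a double contraction, antisymmetric by
    [contract_anti]; pairs further inside are handled by [adj_anti_contract]. *)
Lemma pfaffian_seq_anti t : adj_anti (pfaffian_seq t).
Proof.
elim: t => [|t IH] [|z l1] x y l2 /=; rewrite ?oppr0 //.
- case: t {IH} => [|t] /=.
    by rewrite !(@contract_zero _ (fun=> 0)) //= J_skew; ring.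
  by rewrite contract_anti (J_skew y x); ring.
- exact: adj_anti_contract.
Qed.

Lemma pfaffian_seq_zero t : adj_zero (pfaffian_seq t).
Proof.
elim: t => [|t IH] [|z l1] x l2 //=.
- by case: t {IH} => [|t] /=; rewrite ?contract_contract ?(@contract_zero _ (fun=> 0)) // J_diag; ring.
- exact: adj_zero_contract.
Qed.

Lemma pfaffian_seq_repeat t x l1 l2 l3 :
  pfaffian_seq t (l1 ++ x :: l2 ++ x :: l3) = 0.
Proof.
elim: l2 l1 => [|y l2 IH] l1 /=; first exact: pfaffian_seq_zero.
by rewrite pfaffian_seq_anti -cat_rcons IH oppr0.
Qed.

Lemma contract_codom f g N (d : 'I_N.+1 -> T) :
  contract f g (codom d) =
  \sum_(j < N.+1) (-1) ^+ j * f (d j) * g (codom (d \o lift j)).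
Proof.
have codomS M (e : 'I_M.+1 -> T) : codom e = e ord0 :: codom (e \o lift ord0).
  by rewrite !codomE enum_ordSl /= -map_comp.
elim: N d g => [|N IH] d g.
  rewrite codomS big_ord_recl big_ord0 /= expr0 codomE (size0nil (s := enum _)) /=.
    by ring.
  by rewrite size_enum_ord.
rewrite codomS /= IH [RHS]big_ord_recl expr0 mul1r; congr (_ + _).
rewrite -sumrN; apply: eq_bigr => j _.
rewrite [codom (d \o lift (lift _ _))]codomS exprS mulN1r !mulNr.
congr (- (_ * _ * g (_ :: _))); first by congr d; apply: val_inj.
apply: eq_codom => k /=; congr d; apply: val_inj => /=.
by rewrite /bump; lia.
Qed.

Lemma pfaffianE t (c : 'I_t.*2 -> T) :
  pfaffian (\matrix_(i, j) J (c i) (c j)) = pfaffian_seq t (codom c).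
Proof.
have codomS M (e : 'I_M.+1 -> T) : codom e = e ord0 :: codom (e \o lift ord0).
  by rewrite !codomE enum_ordSl /= -map_comp.
elim: t c => [|t IH] c.
  have all1 (s : 'S_0.*2) : s = 1%g by apply/permP=> -[].
  rewrite /pfaffian (big_pred1 (1%g : 'S_0.*2)); last first.
    move=> s; rewrite /= [in RHS](all1 s) eqxx.
    by apply/andP; split; apply/forallP => -[].
  by rewrite odd_perm1 big_ord0 codomE (size0nil (s := enum _)) ?size_enum_ord //=; ring.
rewrite pfaffian_expand [codom c]codomS /= contract_codom.
apply: eq_bigr => j _; rewrite mxE; congr (_ * _).
rewrite -IH; congr pfaffian; apply/matrixP => x y; by rewrite !mxE.
Qed.

End PfaffianOnSequences.

(** On sequences, sign changes move a repeated entry next to its copy, and [pfaffian_seq_zero] then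
    gives 0 in every characteristic. *)
Lemma pfaffian_noninj (R : comNzRingType) (T : finType) (J : T -> T -> R) t
    (c : 'I_t.*2 -> T) :
  (forall x, J x x = 0) -> (forall x y, J x y = - J y x) ->
  ~ injective c -> pfaffian (\matrix_(i, j) J (c i) (c j)) = 0.
Proof.
move=> J_diag J_skew c_ninj; rewrite pfaffianE.
have [x [l1 [l2 [l3 ->]]]] :
    exists x l1 l2 l3, codom c = l1 ++ x :: l2 ++ x :: l3.
  have : ~~ uniq (codom c) by apply/negP => /injectiveP.
  elim: (codom c) => [|x l IH] //=; rewrite negb_and negbK => /orP[x_l|/IH].
    by have [l1 l2] := splitPr x_l; exists x, [::], l1, l2.
  by move=> [y [l1 [l2 [l3 ->]]]]; exists y, (x :: l1), l2, l3.
exact: pfaffian_seq_repeat.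
Qed.

Lemma big_ord_double (R : comNzRingType) t (F : 'I_t.*2 -> R) :
  \prod_i F i = \prod_(i < t) (F (ord_even i) * F (ord_odd i)).
Proof.
elim: t F => [|t IH] F; first by rewrite !big_ord0.
rewrite (big_ord_recl t.*2.+1) big_ord_recl IH [RHS]big_ord_recl mulrA.
congr (_ * _ * _); first by congr F; apply: val_inj.
  by congr F; apply: val_inj.
by apply: eq_bigr => i _; congr (F _ * F _); apply: val_inj.
Qed.

Lemma ord_evenVodd t (x : 'I_t.*2) : exists i, x = ord_even i \/ x = ord_odd i.
Proof.
have half_lt : (x./2 < t)%N by have := ltn_ord x; lia.
exists (Ordinal half_lt); case: (boolP (odd x)) => odd_x; [right | left];
  by apply: val_inj => /=; lia.
Qed.

(** Multilinearity for the congruence P J P^T: a matching uses each row once, so multiplying out its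
    product amounts to choosing one c i for each row i. *)
Lemma pfaffian_expand_rows (R : comNzRingType) (T : finType) (J : T -> T -> R) t
    (P : 'I_t.*2 -> T -> R) :
  pfaffian (\matrix_(i, j) \sum_x \sum_y P i x * P j y * J x y) =
  \sum_(c : {ffun 'I_t.*2 -> T})
     (\prod_i P i (c i)) * pfaffian (\matrix_(i, j) J (c i) (c j)).
Proof.
rewrite /pfaffian; under [RHS]eq_bigr do rewrite big_distrr /=.
rewrite exchange_big /=; apply: eq_bigr => s _.
under [RHS]eq_bigr do rewrite mulrCA.
rewrite -big_distrr /=; congr (_ * _).
under [LHS]eq_bigr do rewrite mxE pair_big.
rewrite bigA_distr_bigA /=.
(* Choices on the rows correspond to choices of a pair on each edge of the matching s; surjectivity
   follows by counting. *)
pose h (c : {ffun 'I_t.*2 -> T}) : {ffun 'I_t -> T * T} :=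
  [ffun i => (c (s (ord_even i)), c (s (ord_odd i)))].
have h_inj : injective h.
  move=> c c' /ffunP E; apply/ffunP=> x; rewrite -[x](permKV s).
  have [i [->|->]] := ord_evenVodd ((s^-1)%g x); have := E i.
    by rewrite !ffunE => -[].
  by rewrite !ffunE => -[].
rewrite (reindex h) /=; last first.
  apply: onW_bij; apply: inj_card_bij h_inj _.
  by rewrite !card_ffun card_prod !card_ord -mul2n expnM mulnn.
apply: eq_bigr => c _.
rewrite (reindex_perm s) big_ord_double -big_split /=.
by apply: eq_bigr => i _; rewrite !ffunE /= !mxE.
Qed.

(** In the expansion, non-injective choices vanish by the repeated index and injective ones by a
    zero factor. This covers both proportional rows and low rank. *)
Lemma pfaffian_zero_rank (R : comNzRingType) (T : finType) (J : T -> T -> R) t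
    (P : 'I_t.*2 -> T -> R) :
  (forall x, J x x = 0) -> (forall x y, J x y = - J y x) ->
  (forall c : 'I_t.*2 -> T, injective c -> exists i, P i (c i) = 0) ->
  pfaffian (\matrix_(i, j) \sum_x \sum_y P i x * P j y * J x y) = 0.
Proof.
move=> J_diag J_skew P0; rewrite pfaffian_expand_rows big1 // => c _.
have [/P0[i Pi0] | c_ninj] := classic (injective c).
  by rewrite (bigD1 i) //= Pi0 !mul0r.
by rewrite pfaffian_noninj ?mulr0.
Qed.

(** * The rearrangement inequality *)

Section Rearrangement.
Local Open Scope nat_scope.
Implicit Types L : seq (nat * nat).

Definition pairing_weight L : nat := \sum_(x <- L) x.1 * x.2.

Definition sorted_pairing L : Prop :=
  forall x y : nat * nat, x \in L -> y \in L -> x.1 < y.1 -> x.2 <= y.2.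

(** A pair with the largest first coordinate, ties broken by the second, is also largest in the
    second coordinate. *)
Lemma sorted_pairing_max L :
  sorted_pairing L -> L != [::] ->
  exists2 x : nat * nat, x \in L & forall y : nat * nat, y \in L -> y.1 <= x.1 /\ y.2 <= x.2.
Proof.
elim: L => // x L IH sL _; have [->|L0] := eqVneq L [::].
  by exists x; rewrite ?mem_head // => y; rewrite inE => /eqP->.
have sL' : sorted_pairing L.
  by move=> y z yL zL; apply: sL; rewrite inE ?yL ?zL orbT.
have [z zL zmax] := IH sL' L0.
have zL' : z \in x :: L by rewrite inE zL orbT.
have xL : x \in x :: L := mem_head _ _.
have := sL _ _ xL zL'; have := sL _ _ zL' xL.
have [x_le|x_gt] := leqP x.1 z.1; last first.
  move=> /(_ isT) z2 _; exists x => // y; rewrite inE => /predU1P[->|/zmax[? ?]]; lia.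
have [E|NE] := eqVneq x.1 z.1; last first.
  move=> _ x2; exists z => // y; rewrite inE => /predU1P[->|/zmax //].
  by split=> //; apply: x2; lia.
move=> _ _; have [x2|x2] := leqP x.2 z.2; [exists z | exists x] => // y;
  rewrite inE => /predU1P[->|/zmax[? ?]] //; lia.
Qed.

Lemma ltn_mul_swap p P q Q : p < P -> q < Q -> P * q + p * Q < P * Q + p * q.
Proof. by move=> /subnKC <- /subnKC <-; rewrite !mulnDl !mulnDr !mulSn !mulnS; lia. Qed.

Lemma pairing_weight_perm L L' : perm_eq L L' -> pairing_weight L = pairing_weight L'.
Proof. exact: perm_big. Qed.

(** Let m be the pair of L maximal in both coordinates. If m lies in L', remove it from both lists.
    Otherwise L' contains (m.1, q1) and (p1, m.2) with p1 < m.1 and q1 < m.2; replacing them by m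
    and (p1, q1) strictly increases the weight, and induction applies to what remains without m. *)
Lemma rearrangement L L' :
  sorted_pairing L ->
  perm_eq (unzip1 L') (unzip1 L) -> perm_eq (unzip2 L') (unzip2 L) ->
  pairing_weight L' <= pairing_weight L ?= iff perm_eq L' L.
Proof.
have [n] := ubnP (size L); elim: n L L' => // n IH L L' ltLn sL e1 e2.
have [L0|/(sorted_pairing_max sL)[m mL mmax]] := eqVneq L [::].
  move: e1; rewrite L0 => /perm_size /=; rewrite size_map => /size0nil ->.
  by split=> //; rewrite eqxx.
have eL := perm_to_rem mL.
have sL1 : sorted_pairing (rem m L).
  by move=> x y /mem_rem xL /mem_rem; apply: sL.
have ltL1 : size (rem m L) < n by rewrite size_rem //; case: (L) mL ltLn.
have WL : pairing_weight L = m.1 * m.2 + pairing_weight (rem m L).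
  by rewrite (pairing_weight_perm eL) /pairing_weight big_cons.
have [mL'|mL'] := boolP (m \in L').
  have eL' := perm_to_rem mL'.
  have WL' : pairing_weight L' = m.1 * m.2 + pairing_weight (rem m L').
    by rewrite (pairing_weight_perm eL') /pairing_weight big_cons.
  have e1' : perm_eq (unzip1 (rem m L')) (unzip1 (rem m L)).
    rewrite -(perm_cons m.1); apply: perm_trans (perm_map fst eL).
    by apply: perm_trans e1; rewrite perm_sym; exact: (perm_map fst eL').
  have e2' : perm_eq (unzip2 (rem m L')) (unzip2 (rem m L)).
    rewrite -(perm_cons m.2); apply: perm_trans (perm_map snd eL).
    by apply: perm_trans e2; rewrite perm_sym; exact: (perm_map snd eL').
  have [le1 eq1] := IH _ _ ltL1 sL1 e1' e2'.
  split; first by rewrite WL WL' leq_add2l.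
  rewrite WL WL' eqn_add2l eq1 (permPl eL') [RHS]perm_sym (permPl eL) perm_cons.
  exact: perm_sym.
have /mapP[[a1 q1] aL' /= Ea] : m.1 \in unzip1 L'.
  by rewrite (perm_mem e1) map_f.
have /mapP[[p1 b2] bL' /= Eb] : m.2 \in unzip2 L'.
  by rewrite (perm_mem e2) map_f.
subst a1 b2.
have nab : (p1, m.2) != (m.1, q1).
  apply: contraNneq mL' => -[E _]; by rewrite (surjective_pairing m) -E.
have eL'a := perm_to_rem aL'.
have bL'' : (p1, m.2) \in rem (m.1, q1) L'.
  by move: bL'; rewrite (perm_mem eL'a) inE (negPf nab).
have eL' : perm_eq L' [:: (m.1, q1), (p1, m.2) & rem (p1, m.2) (rem (m.1, q1) L')].
  by rewrite (perm_trans eL'a) // perm_cons perm_to_rem.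
set L3 := rem _ (rem _ _) in eL'.
have e1' : perm_eq (unzip1 ((p1, q1) :: L3)) (unzip1 (rem m L)).
  rewrite -(perm_cons m.1); apply: perm_trans (perm_map fst eL).
  by apply: perm_trans e1; rewrite perm_sym; exact: (perm_map fst eL').
have e2' : perm_eq (unzip2 ((p1, q1) :: L3)) (unzip2 (rem m L)).
  rewrite -(perm_cons m.2); apply: perm_trans (perm_map snd eL).
  apply: perm_trans e2; rewrite perm_sym (permPl (perm_map snd eL')) /=.
  by rewrite -[_ :: _]/([:: q1] ++ [:: m.2] ++ unzip2 L3) perm_catCA.
have [le1 _] := IH _ _ ltL1 sL1 e1' e2'.
have lt_p1 : p1 < m.1.
  have /mapP[[x y] /mem_rem/mmax[/= + _] E1] : p1 \in unzip1 (rem m L).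
    by rewrite -(perm_mem e1') mem_head.
  rewrite -[x]/((x, y).1) -E1 leq_eqVlt => /predU1P[E|//]; case/negP: mL'.
  by rewrite (surjective_pairing m) -E.
have lt_q1 : q1 < m.2.
  have /mapP[[x y] /mem_rem/mmax[/= _ +] E1] : q1 \in unzip2 (rem m L).
    by rewrite -(perm_mem e2') mem_head.
  rewrite -[y]/((x, y).2) -E1 leq_eqVlt => /predU1P[E|//]; case/negP: mL'.
  by rewrite (surjective_pairing m) -E.
have lt_w : pairing_weight L' < pairing_weight L.
  move: le1 (ltn_mul_swap lt_p1 lt_q1).
  rewrite WL (pairing_weight_perm eL') /pairing_weight !big_cons /=; clear; lia.
split; first exact: ltnW.
rewrite ltn_eqF //; apply/esym/negP=> /perm_mem E.
by rewrite E mL in mL'.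
Qed.
End Rearrangement.

(** * Coefficients of products of sums *)

Lemma mcoeff_prod_sum (K : comNzRingType) N (I : eqType) (C : finType)
    (A : I -> C -> K) (mon : I -> C -> 'X_{1..N}) (s : seq I) (M : 'X_{1..N}) :
  (\prod_(x <- s) \sum_c A x c *: 'X_[mon x c])@_M =
  \sum_(g : {ffun 'I_(size s) -> C} |
         (\sum_i mon (tnth (in_tuple s) i) (g i))%MM == M)
    \prod_i A (tnth (in_tuple s) i) (g i).
Proof.
rewrite big_tnth bigA_distr_bigA /= raddf_sum [RHS]big_mkcond /=.
apply: eq_bigr => g _.
rewrite scaler_prod mprodXE mcoeffZ mcoeffX.
by case: (_ == M); rewrite ?mulr1 ?mulr0.
Qed.

Lemma big_choice (R : Type) (idx : R) (op : Monoid.com_law idx) (I C : Type)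
    (s : seq I) (g : 'I_(size s) -> C) (F : I -> C -> R) :
  \big[op/idx]_i F (tnth (in_tuple s) i) (g i) =
  \big[op/idx]_(x <- [seq (tnth (in_tuple s) i, g i) | i <- enum 'I_(size s)])
     F x.1 x.2.
Proof. by rewrite big_map big_enum. Qed.

Lemma unzip1_choice (I C : Type) (s : seq I) (g : 'I_(size s) -> C) :
  unzip1 [seq (tnth (in_tuple s) i, g i) | i <- enum 'I_(size s)] = s.
Proof.
rewrite /unzip1 -map_comp (eq_map (g := tnth (in_tuple s))) //.
by rewrite map_tnth_enum.
Qed.

Lemma mcoeff_prod_sum_eq0 (K : comNzRingType) N (I : eqType) (C : finType)
    (A : I -> C -> K) (mon : I -> C -> 'X_{1..N}) (s : seq I) (M : 'X_{1..N}) :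
  (forall gs : seq (I * C), unzip1 gs = s ->
     (\sum_(x <- gs) mon x.1 x.2)%MM <> M) ->
  (\prod_(x <- s) \sum_c A x c *: 'X_[mon x c])@_M = 0.
Proof.
move=> H; rewrite mcoeff_prod_sum big1 // => g /eqP Eg.
by case: (H _ (unzip1_choice g)); rewrite -big_choice.
Qed.

(** The monomial selected by k arises from no other choice of terms, so nothing can cancel its
    coefficient. *)
Lemma mcoeff_prod_sum_uniq (K : comNzRingType) N (I : eqType) (C : finType)
    (A : I -> C -> K) (mon : I -> C -> 'X_{1..N}) (s : seq I) (k : I -> C) :
  (forall gs : seq (I * C), unzip1 gs = s ->
     (\sum_(x <- gs) mon x.1 x.2)%MM = (\sum_(x <- s) mon x (k x))%MM ->
     forall x, x \in gs -> x.2 = k x.1) ->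
  (\prod_(x <- s) \sum_c A x c *: 'X_[mon x c])@_(\sum_(x <- s) mon x (k x))%MM
  = \prod_(x <- s) A x (k x).
Proof.
move=> H; rewrite mcoeff_prod_sum.
rewrite (big_pred1 [ffun i => k (tnth (in_tuple s) i)]) => [|g] /=.
  by rewrite [RHS]big_tnth; apply: eq_bigr => i _; rewrite ffunE.
apply/eqP/eqP => [Eg | ->]; last first.
  by rewrite [RHS]big_tnth; apply: eq_bigr => i _; rewrite ffunE.
rewrite big_choice in Eg; apply/ffunP=> i; rewrite ffunE.
by apply: (H _ (unzip1_choice g) Eg (_, _)); rewrite map_f ?mem_enum.
Qed.

(** * Monomials as multisets of variables *)

Lemma perm_eq_count (T : eqType) (s1 s2 : seq T) :
  (forall x, count_mem x s1 = count_mem x s2) -> perm_eq s1 s2.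
Proof. by move=> H; apply/allP => x _; rewrite /= H. Qed.

(** Listing variables with multiplicity lets each occurrence choose its own term when the image of a
    monomial is multiplied out. *)
Definition mnm_seq N (m : 'X_{1..N}) : seq 'I_N :=
  flatten [seq nseq (m z) z | z <- enum 'I_N].

Lemma count_mnm_seq N (m : 'X_{1..N}) z : count_mem z (mnm_seq m) = m z.
Proof.
rewrite /mnm_seq count_flatten -map_comp sumnE big_map big_enum /=.
rewrite (bigD1 z) //= count_nseq /= eqxx mul1n big1 ?addn0 // => y /negPf yz.
by rewrite count_nseq /= yz mul0n.
Qed.

Lemma mem_mnm_seq N (m : 'X_{1..N}) z : (z \in mnm_seq m) = (0 < m z)%N.
Proof. by rewrite -count_mnm_seq -has_count has_pred1. Qed.

Lemma mmap1_mnm_seq N (S : comNzRingType) (h : 'I_N -> S) (m : 'X_{1..N}) :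
  mmap1 h m = \prod_(z <- mnm_seq m) h z.
Proof.
rewrite /mnm_seq big_flatten big_map big_enum /=.
by apply: eq_bigr => z _; rewrite big_nseq iter_mulr_1.
Qed.

Lemma lex_min (T : eqType) (s : seq T) (f g : T -> nat) :
  s != [::] -> exists2 x, x \in s & forall y, y \in s ->
    (f x <= f y)%N /\ (f x = f y -> (g x <= g y)%N).
Proof.
elim: s => // x s IH _; have [->|/IH[z zs zmin]] := eqVneq s [::].
  by exists x; rewrite ?mem_head // => y; rewrite inE => /eqP->.
have [le_xz|lt_zx] := boolP ((f x < f z) || (f x == f z) && (g x <= g z))%N.
  exists x; rewrite ?mem_head // => y; rewrite inE => /predU1P[->//|/zmin[]]; lia.
exists z; first by rewrite inE zs orbT.
by move=> y; rewrite inE => /predU1P[->|/zmin //]; lia.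
Qed.

Lemma sorted_ltn_gap (s : seq nat) i j :
  sorted ltn s -> (i <= j)%N -> (j < size s)%N ->
  (nth 0 s i + (j - i) <= nth 0 s j)%N.
Proof.
move=> sort_s; elim: j => [|j IH]; first by rewrite leqn0 => /eqP->; rewrite addn0.
rewrite leq_eqVlt => /predU1P[-> _|lt_ij lt_j]; first by rewrite subnn addn0.
have /(sortedP 0%N)/(_ _ lt_j) /= := sort_s.
have := IH lt_ij (ltnW lt_j); lia.
Qed.

(** * Reduction modulo leading monomials *)

Section Ideals.
Variables (R : comNzRingType).
Implicit Types (S : R -> Prop) (f g : R).

Lemma ideal_gen_mem S f : S f -> ideal_gen S f.
Proof.
by move=> Sf; exists 1%N, (fun=> 1), (fun=> f); split=> //; rewrite big_ord1 mul1r.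
Qed.

Lemma ideal_gen0 S : ideal_gen S 0.
Proof.
exists 0%N, (fun=> 0), (fun=> 0); split; first by case.
by rewrite big_ord0.
Qed.

Lemma ideal_genD S f g : ideal_gen S f -> ideal_gen S g -> ideal_gen S (f + g).
Proof.
move=> [m [c [h [Sh ->]]]] [m' [c' [h' [Sh' ->]]]].
exists (m + m')%N, (fun k => match split k with inl i => c i | inr j => c' j end),
  (fun k => match split k with inl i => h i | inr j => h' j end).
split=> [k|]; first by case: split.
rewrite big_split_ord; congr (_ + _); apply: eq_bigr => i _.
  by rewrite (unsplitK (inl i)).
by rewrite (unsplitK (inr i)).
Qed.

Lemma ideal_genM S c f : ideal_gen S f -> ideal_gen S (c * f).
Proof.
move=> [m [d [h [Sh ->]]]]; exists m, (fun k => c * d k), h; split=> //.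
by rewrite big_distrr; apply: eq_bigr => k _; rewrite /= mulrA.
Qed.

Lemma ideal_genB S f g : ideal_gen S f -> ideal_gen S g -> ideal_gen S (f - g).
Proof. by move=> Sf Sg; rewrite -mulN1r; apply: ideal_genD => //; apply: ideal_genM. Qed.

Lemma ideal_gen_sub S S' f :
  (forall g, S g -> ideal_gen S' g) -> ideal_gen S f -> ideal_gen S' f.
Proof.
move=> SS' [m [c [h [Sh ->]]]].
elim/big_ind: _ => [|f1 f2|k _]; [exact: ideal_gen0 | exact: ideal_genD |].
exact/ideal_genM/SS'.
Qed.

End Ideals.

Section Reduction.
Variables (K : fieldType) (N : nat) (le : rel 'X_{1..N}) (S : {mpoly K[N]} -> Prop).
Hypothesis le_order : term_order le.
Variable D : 'X_{1..N} -> Prop.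
Hypothesis D_lead : forall m, D m -> exists p,
  [/\ ideal_gen S p, is_initial le p m & p \is (mdeg m).-homog].

(** The polynomial h is a normal form of f modulo the leading monomials in [D]; B records where its
    monomials lie, so that a given leading term can be protected from cancellation. *)
Definition reducible_below (B : 'X_{1..N} -> Prop) (f : {mpoly K[N]}) : Prop :=
  exists2 h, ideal_gen S (f - h) & forall m, m \in msupp h -> ~ D m /\ B m.

Lemma reducible_below0 B : reducible_below B 0.
Proof. by exists 0; rewrite ?subrr; [exact: ideal_gen0 | move=> m; rewrite msupp0]. Qed.

Lemma reducible_belowD B f g :
  reducible_below B f -> reducible_below B g -> reducible_below B (f + g).
Proof.
move=> [h Sf hB] [h' Sg hB']; exists (h + h').
  by rewrite opprD addrACA; apply: ideal_genD.
by move=> m /msuppD_le; rewrite mem_cat => /orP[/hB|/hB'].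
Qed.

Lemma reducible_belowZ B c f : reducible_below B f -> reducible_below B (c *: f).
Proof.
move=> [h Sf hB]; exists (c *: h); last by move=> m /msuppZ_le/hB.
by rewrite -scalerBr -mul_mpolyC; apply: ideal_genM.
Qed.

Lemma reducible_below_sum B (f : {mpoly K[N]}) (P : pred 'X_{1..N}) :
  (forall m, m \in msupp f -> P m -> reducible_below B 'X_[m]) ->
  reducible_below B (\sum_(m <- msupp f | P m) f@_m *: 'X_[m]).
Proof.
move=> H; rewrite big_seq_cond.
elim/big_ind: _ => [|f1 f2|m /andP[mf Pm]];
  [exact: reducible_below0 | exact: reducible_belowD |].
exact/reducible_belowZ/H.
Qed.

Lemma reducible_below_le (B B' : 'X_{1..N} -> Prop) f :
  (forall m, B m -> B' m) -> reducible_below B f -> reducible_below B' f.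
Proof. by move=> BB' [h Sf hB]; exists h => // m /hB[? /BB']. Qed.

(** Subtracting a multiple of p replaces m by smaller monomials. Since p is homogeneous these have
    the degree of m, and only finitely many monomials of that degree lie below m, so the recursion
    ends. *)
Lemma reducible_monomial m : reducible_below (fun m' => le m' m) 'X_[m].
Proof.
have [le_tot le_anti le_tr _ _] := le_order.
have le_refl x : le x x by have := le_tot x x; rewrite orbb.
pose below d (x : 'X_{1..N}) : {set 'X_{1..N < d.+1}} :=
  [set y : 'X_{1..N < d.+1} | le y x && (y != x :> 'X_{1..N})].
have [k] := ubnP #|below (mdeg m) m|; elim: k m => // k IH m; rewrite ltnS => le_k.
have [Dm|nDm] := classic (D m); last first.
  exists 'X_[m]; first by rewrite subrr; apply: ideal_gen0.
  by move=> m'; rewrite msuppX inE => /eqP->.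
have [p [Ip [mp p_le] p_hom]] := D_lead Dm.
have cm : p@_m != 0 by rewrite -mcoeff_msupp.
have tail : reducible_below (fun m' => le m' m)
    (\sum_(m' <- msupp p | m' != m) p@_m' *: 'X_[m']).
  apply: reducible_below_sum => m' m'p ne.
  have le_m' := p_le _ m'p.
  apply: (@reducible_below_le (fun m'' => le m'' m')); first by move=> x /le_tr; apply.
  have deg_m' : mdeg m' = mdeg m by have /dhomogP/(_ m' m'p) := p_hom.
  (* The inclusion is strict: m' lies strictly below m but not strictly below itself. *)
  apply: IH; rewrite deg_m'; apply: leq_trans le_k; apply: proper_card.
  apply/properP; split.
    apply/subsetP=> x; rewrite !inE => /andP[le_x ne_x].
    rewrite (le_tr _ _ _ le_x le_m'); apply: contraNneq ne_x => E.
    by apply/eqP/le_anti; rewrite le_x E le_m'.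
  have lt_d : (mdeg m' < (mdeg m).+1)%N by rewrite deg_m'.
  by exists (BMultinom lt_d); rewrite !inE /= ?le_m' ?ne // eqxx andbF.
have pE : p = p@_m *: 'X_[m] + \sum_(m' <- msupp p | m' != m) p@_m' *: 'X_[m'].
  by rewrite {1}[p]mpolyE (bigD1_seq m) ?msupp_uniq.
have [h Ih hB] := reducible_belowZ (- (p@_m)^-1) tail.
exists h => //.
rewrite (_ : _ - h = (p@_m)^-1%:MP * p +
  (- (p@_m)^-1 *: (\sum_(m' <- msupp p | m' != m) p@_m' *: 'X_[m']) - h)).
  by apply: ideal_genD => //; apply: ideal_genM.
move: pE cm {tail Ih hB}; set c := p@_m; set T := \sum_(_ <- _ | _) _.
move: c T => c T -> c0; rewrite mul_mpolyC scalerDr scalerA mulVf // scale1r scaleNr.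
by rewrite addrA addrK.
Qed.

(** Only the tail of f is reduced. The resulting monomials stay below m, so the leading term
    survives and the result is nonzero. *)
Lemma standard_representative f m :
  ideal_gen S f -> is_initial le f m -> ~ D m ->
  exists h, [/\ ideal_gen S h, h != 0 & forall m', m' \in msupp h -> ~ D m'].
Proof.
move=> If [mf f_le] nDm; have [_ le_anti le_tr _ _] := le_order.
have tail : reducible_below (fun m' => m' != m)
    (\sum_(m' <- msupp f | m' != m) f@_m' *: 'X_[m']).
  apply: reducible_below_sum => m' m'f ne.
  apply: reducible_below_le (reducible_monomial m') => x le_x.
  apply: contraNneq ne => E; apply/eqP/le_anti.
  by rewrite f_le // -E.
have fE : f = f@_m *: 'X_[m] + \sum_(m' <- msupp f | m' != m) f@_m' *: 'X_[m'].
  by rewrite {1}[f]mpolyE (bigD1_seq m) ?msupp_uniq.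
have [h Ih hB] := tail; exists (f@_m *: 'X_[m] + h); split.
- rewrite (_ : _ + h = f -
     (\sum_(m' <- msupp f | m' != m) f@_m' *: 'X_[m'] - h)); first exact: ideal_genB.
  move: fE {tail}; set c := f@_m; set T := \sum_(_ <- _ | _) _.
  by move: c T => c T ->; rewrite opprB addrACA subrr addr0.
- apply: contraTneq mf => /(congr1 (mcoeff m)).
  rewrite mcoeffD mcoeffZ mcoeffX eqxx mulr1 mcoeff0 -mcoeff_eq0 => E.
  rewrite -E [h@_m](_ : _ = 0) ?addr0 //; apply/eqP; rewrite mcoeff_eq0.
  by apply/negP => /hB[_ /eqP].
- move=> m' /msuppD_le; rewrite mem_cat => /orP[/msuppZ_le|/hB[]//].
  by rewrite msuppX inE => /eqP->.
Qed.
End Reduction.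

(** * The substitution *)

Section Specialization.
Variables (K : fieldType) (n r a b : nat) (i0 : 'I_n).
Hypotheses (i0E : i0 = 0%N :> nat) (a_gt1 : (1 < a)%N).

Definition low (i : 'I_n) : bool := (lab i <= a - 1)%N.
Definition proj (i : 'I_n) : 'I_n := if low i then i0 else i.

Definition arc (z : 'I_(nvar n)) : 'I_n * 'I_n := val (enum_val z : upos n).
Definition arc1 z := (arc z).1.
Definition arc2 z := (arc z).2.

Lemma arc_lt z : (arc1 z < arc2 z)%N.
Proof. exact: (valP (enum_val z : upos n)). Qed.

Lemma arc_inj : injective arc.
Proof. by move=> z z' /val_inj/enum_val_inj. Qed.

Lemma xmonE (i j : 'I_n) : (i < j)%N -> exists2 z, xmon i j = U_(z)%MM & arc z = (i, j).
Proof.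
move=> ij; rewrite /xmon; case: insubP => [p _ pE|]; last by rewrite ij.
by exists (enum_rank p) => //; rewrite /arc enum_rankK.
Qed.

(** [inl i] stands for c_i, [inr (true, (k, p))] for v^k_p and [inr (false, (k, p))] for w^k_p.
    There are t = [r.+1] summands. *)
Definition param := ('I_n + bool * ('I_r.+1 * 'I_n))%type.
Notation S := {mpoly K[#|{: param}|]}.

Definition scale_var (i : 'I_n) : param := inl i.
Definition form_var (e : bool) (k : 'I_r.+1) (p : 'I_n) : param := inr (e, (k, p)).
Definition pmon (x : param) : 'X_{1..#|{: param}|} := U_(enum_rank x)%MM.

Definition scale_mon (i : 'I_n) : 'X_{1..#|{: param}|} :=
  if low i then pmon (scale_var i) else 0%MM.

Definition allowed (k : 'I_r.+1) (q : 'I_n) : bool :=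
  (k == ord_max) ==> (b <= lab q)%N.

Definition term_mon (k : 'I_r.+1) (p q : 'I_n) : 'X_{1..#|{: param}|} :=
  (pmon (form_var true k p) + pmon (form_var false k q))%MM.

(* The factor w_q of the last summand is truncated to the columns q >= b. *)
Definition form_entry (k : 'I_r.+1) (p q : 'I_n) : S :=
  (allowed k q)%:R *: 'X_[term_mon k p q] - (allowed k p)%:R *: 'X_[term_mon k q p].

Definition spec_entry (i j : 'I_n) : S :=
  'X_[scale_mon i] * 'X_[scale_mon j] *
    \sum_(k < r.+1) form_entry k (proj i) (proj j).

Definition spec : {mpoly K[nvar n]} -> S :=
  mmap (@mpolyC _ K) (fun z => spec_entry (arc1 z) (arc2 z)).
HB.instance Definition _ := GRing.RMorphism.on spec.

Lemma form_entry_skew k p q : form_entry k p q = - form_entry k q p.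
Proof. by rewrite /form_entry opprB. Qed.

Lemma spec_entry_skew i j : spec_entry i j = - spec_entry j i.
Proof.
rewrite /spec_entry [X in _ = - (X * _)]mulrC -mulrN -sumrN.
by congr (_ * _); apply: eq_bigr => k _; apply: form_entry_skew.
Qed.

Lemma spec_genX i j : spec (genX K n i j) = spec_entry i j.
Proof.
have specX (p q : 'I_n) : (p < q)%N -> spec 'X_[xmon p q] = spec_entry p q.
  move=> /xmonE[z -> zE]; rewrite /spec mmapX mmap1U.
  by rewrite /arc1 /arc2 zE.
rewrite mxE; case: ltngtP => [ij|ij|/val_inj->]; first exact: specX.
  by rewrite rmorphN /= specX // -spec_entry_skew.
rewrite rmorph0 /spec_entry big1 ?mulr0 // => k _.
by rewrite /form_entry subrr.
Qed.

Lemma spec_pfpoly (u : pfidx n) :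
  spec (pfpoly K u) =
  pfaffian (\matrix_(i, j) spec_entry (tnth (pfrows u) i) (tnth (pfrows u) j)).
Proof.
rewrite /pfpoly /pfaffian rmorph_sum /=; apply: eq_bigr => s _.
rewrite rmorphM rmorph_sign rmorph_prod /=; congr (_ * _).
by apply: eq_bigr => i _; rewrite !mxE -spec_genX /genX mxE.
Qed.

(** The rows x and y both project to [i0], hence are proportional, with factors c_i. In the
    factorization P J P^T each row of P has a single nonzero entry, and these two rows have it in
    the same column. *)
Lemma spec_two_low (u : pfidx n) x y :
  x != y -> low (tnth (pfrows u) x) -> low (tnth (pfrows u) y) ->
  spec (pfpoly K u) = 0.
Proof.
move=> xy lx ly; rewrite spec_pfpoly.
pose Om (p q : 'I_n) : S := \sum_(k < r.+1) form_entry k p q.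
pose P (i : 'I_(half_size u).*2) (p : 'I_n) : S :=
  'X_[scale_mon (tnth (pfrows u) i)] * (p == proj (tnth (pfrows u) i))%:R.
rewrite (_ : \matrix_(_, _) _ =
    \matrix_(i, j) \sum_p \sum_q P i p * P j q * Om p q); last first.
  apply/matrixP=> i j; rewrite !mxE.
  rewrite (bigD1 (proj (tnth (pfrows u) i))) //= [X in _ + X]big1 ?addr0; last first.
    by move=> p /negPf ne; rewrite big1 // => q _; rewrite /P ne mulr0 !mul0r.
  rewrite (bigD1 (proj (tnth (pfrows u) j))) //= [X in _ + X]big1 ?addr0; last first.
    by move=> p /negPf ne; rewrite /P ne !mulr0 !mul0r.
  by rewrite /P !eqxx !mulr1.
apply: pfaffian_zero_rank => [p|p q|c c_inj].
- by rewrite /Om big1 // => k _; rewrite /form_entry subrr.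
- by rewrite /Om -sumrN; apply: eq_bigr => k _; apply: form_entry_skew.
have [ex|ne] := eqVneq (c x) (proj (tnth (pfrows u) x)); last first.
  by exists x; rewrite /P (negPf ne) mulr0.
exists y; rewrite /P (_ : _ == _ = false) ?mulr0 //; apply/eqP => ey.
by case/eqP: xy; apply: c_inj; rewrite ex ey /proj lx ly.
Qed.

(** The matrix factors as P J P^T with J the standard alternating form on [r.+1] hyperbolic planes.
    Beyond size 2t no injective choice exists. In size 2t an injective choice is bijective, so it
    hits [(ord_max, false)], whose entries in P vanish by truncation when all labels are below b. *)
Lemma spec_rank (u : pfidx n) :
  (r.+1 < half_size u)%N \/
  half_size u = r.+1 /\ (forall x, lab (tnth (pfrows u) x) < b)%N ->
  spec (pfpoly K u) = 0.
Proof.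
move=> Hu; rewrite spec_pfpoly.
pose J (x y : 'I_r.+1 * bool) : S :=
  if x.1 == y.1 then (x.2 && ~~ y.2)%:R - (~~ x.2 && y.2)%:R else 0.
pose P (i : 'I_(half_size u).*2) (x : 'I_r.+1 * bool) : S :=
  let p := proj (tnth (pfrows u) i) in
  'X_[scale_mon (tnth (pfrows u) i)] *
   (if x.2 then 'X_[pmon (form_var true x.1 p)]
    else (allowed x.1 p)%:R *: 'X_[pmon (form_var false x.1 p)]).
rewrite (_ : \matrix_(_, _) _ =
    \matrix_(i, j) \sum_x \sum_y P i x * P j y * J x y); last first.
  apply/matrixP=> i j; rewrite !mxE /spec_entry big_distrr /=.
  rewrite -(pair_bigA _ (fun k e => \sum_y P i (k, e) * P j y * J (k, e) y)) /=.
  apply: eq_bigr => k _.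
  have sumJ e : \sum_y P i (k, e) * P j y * J (k, e) y =
      \sum_e' P i (k, e) * P j (k, e') * J (k, e) (k, e').
    rewrite -(pair_bigA _ (fun k' e' => P i (k, e) * P j (k', e') * J (k, e) (k', e'))) /=.
    rewrite (bigD1 k) //= [X in _ + X]big1 ?addr0 // => k' /negPf ne.
    by rewrite big1 // => e' _; rewrite /J /= eq_sym ne mulr0.
  rewrite big_bool !sumJ !big_bool /P /J /form_entry /term_mon /= eqxx !mpolyXD.
  rewrite -!mul_mpolyC !rmorph_nat; ring.
apply: pfaffian_zero_rank => [x|x y|c c_inj].
- by rewrite /J eqxx; case: x.2; rewrite subrr.
- by rewrite /J eq_sym; case: ifP => _; rewrite ?oppr0 // opprB ![_ && ~~ _]andbC.
have card_T : #|{: 'I_r.+1 * bool}| = r.+1.*2 by rewrite card_prod card_ord card_bool muln2.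
case: Hu => [lt_ru | [Eu lt_b]].
  by have := leq_card c c_inj; rewrite card_T card_ord leq_double leqNgt lt_ru.
have /inj_card_bij : injective c := c_inj.
case; first by rewrite card_T card_ord Eu.
move=> c' _ c'K; exists (c' (ord_max, false)); rewrite /P c'K /= /allowed eqxx /=.
set i := tnth _ _; rewrite leqNgt (_ : (lab _ < b)%N); first by rewrite scale0r mulr0.
have := lt_b (c' (ord_max, false)); rewrite -/i /proj; case: ifP => // _.
by apply: leq_ltn_trans; rewrite /lab i0E.
Qed.

(** If u is not too large, some position fails, counted from 0. Position 0 cannot, as labels are at
    least 1. A failure at a position from 1 to 2t-2 forces the second label below a by strict
    growth, giving two low rows. A failure at position 2t-1 means size 2t with all labels below
    b. *)
Lemma spec_not_ge (alpha u : pfidx n) :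
  pflabels alpha = 1%N :: rcons (iota a (2 * r.+1 - 2)) b ->
  ~ pfle alpha u -> spec (pfpoly K u) = 0.
Proof.
move=> alphaE; have half_alpha : half_size alpha = r.+1.
  have := congr1 size alphaE; rewrite size_map size_tuple /= size_rcons size_iota; lia.
rewrite /pfle half_alpha => n_le.
have [lt_ru | le_ur] := ltnP r.+1 (half_size u); first by apply: spec_rank; left.
have size_u : size (pflabels u) = (half_size u).*2 by rewrite size_map size_tuple.
have nth_u (k : 'I_(half_size u).*2) : nth 0%N (pflabels u) k = lab (tnth (pfrows u) k).
  by rewrite (nth_map (tnth (pfrows u) k)) ?size_tuple // -tnth_nth.
have [k lt_k lt_u] : exists2 k, (k < (half_size u).*2)%N &
    (nth 0 (pflabels u) k < nth 0 (pflabels alpha) k)%N.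
  apply: NNPP => H; apply: n_le; split=> // k lt_k; rewrite leqNgt.
  by apply/negP => lt_u; apply: H; exists k.
have gap i j : (i <= j)%N -> (j < (half_size u).*2)%N ->
    (nth 0 (pflabels u) i + (j - i) <= nth 0 (pflabels u) j)%N.
  move=> le_ij; rewrite -size_u => lt_j; apply: sorted_ltn_gap => //.
  exact: pfrows_sorted.
case: k => [|k] in lt_k lt_u *.
  by move: lt_u; rewrite alphaE /= (nth_u (Ordinal lt_k)).
move: lt_u; rewrite alphaE /= nth_rcons size_iota.
case: (ltnP k (2 * r.+1 - 2)) => [lt_kr | ge_kr].
  rewrite nth_iota // => lt_u.
  have lt1 : (1 < (half_size u).*2)%N by lia.
  have lt0 : (0 < (half_size u).*2)%N by lia.
  have := gap 1%N k.+1 isT lt_k; have := gap 0%N 1%N isT lt1.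
  rewrite (nth_u (Ordinal lt0)) (nth_u (Ordinal lt1)) => gap01 gap1k.
  by apply: (@spec_two_low u (Ordinal lt0) (Ordinal lt1)) => //; rewrite /low; lia.
case: eqP => // Ek lt_u.
apply: spec_rank; right; split; first lia.
move=> x; rewrite -nth_u.
have := gap x k.+1; have := ltn_ord x; lia.
Qed.

Lemma spec_cogen_ideal (alpha : pfidx n) f :
  pflabels alpha = 1%N :: rcons (iota a (2 * r.+1 - 2)) b ->
  cogen_ideal alpha f -> spec f = 0.
Proof.
move=> alphaE [m [c [g [Hg ->]]]]; rewrite rmorph_sum big1 //= => k _.
have [beta /(spec_not_ge alphaE) beta0 ->] := Hg k.
by rewrite rmorphM /= beta0 mulr0.
Qed.

(** * Uniqueness of the sorted distribution of arcs *)

(** The summand chosen for an arc, then the index of v and the index of w in the chosen term. The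
    flag [false] selects the negative term, where the ends of the arc exchange roles. *)
Definition oriented (x : 'I_(nvar n) * ('I_r.+1 * bool)) : 'I_r.+1 * ('I_n * 'I_n) :=
  (x.2.1, if x.2.2 then (proj (arc1 x.1), proj (arc2 x.1))
          else (proj (arc2 x.1), proj (arc1 x.1))).

Definition choice_mon (z : 'I_(nvar n)) (c : 'I_r.+1 * bool) :
    'X_{1..#|{: param}|} :=
  let y := oriented (z, c) in
  (scale_mon (arc1 z) + scale_mon (arc2 z) + term_mon y.1 y.2.1 y.2.2)%MM.

Definition choice_coef (z : 'I_(nvar n)) (c : 'I_r.+1 * bool) : K :=
  (-1) ^+ (~~ c.2) * (allowed c.1 (oriented (z, c)).2.2)%:R.

Lemma spec_entry_choice z :
  spec_entry (arc1 z) (arc2 z) =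
  \sum_c choice_coef z c *: 'X_[choice_mon z c].
Proof.
rewrite -(pair_bigA _ (fun k e => choice_coef z (k, e) *: 'X_[choice_mon z (k, e)])) /=.
rewrite /spec_entry big_distrr /=; apply: eq_bigr => k _.
rewrite big_bool /choice_coef /choice_mon /oriented /form_entry /= expr0 expr1.
by rewrite !mpolyXD -!mul_mpolyC !rmorphM !rmorphN !rmorph_nat; ring.
Qed.

Lemma pmonE x y : pmon x (enum_rank y) = (x == y).
Proof. by rewrite /pmon mnm1E (inj_eq enum_rank_inj). Qed.

Definition low_ends (z : 'I_(nvar n)) : seq 'I_n := [seq i <- [:: arc1 z; arc2 z] | low i].

Lemma scale_monE i x : scale_mon i (enum_rank x) = (low i && (scale_var i == x)).
Proof. by rewrite /scale_mon; case: (low i); rewrite ?pmonE // mnm0E. Qed.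

Lemma form_scale_eq e k p i : (form_var e k p == scale_var i) = false.
Proof. by []. Qed.

Lemma scale_form_eq e k p i : (scale_var i == form_var e k p) = false.
Proof. by []. Qed.

Lemma scale_var_eq i j : (scale_var i == scale_var j) = (i == j).
Proof. by []. Qed.

Lemma form_var_eq e k p e' k' p' :
  (form_var e k p == form_var e' k' p') = (e == e') && ((k, p) == (k', p')).
Proof. by []. Qed.

(** What a term of the image remembers: the exponents of the c_i give the multiset of low ends,
    while those of v and w, in [choice_mon_form], give for each summand the multisets of first and
    of second indices. *)
Lemma choice_mon_scale gs i :
  (\sum_(x <- gs) choice_mon x.1 x.2)%MM (enum_rank (scale_var i)) =
  count_mem i (flatten [seq low_ends x.1 | x <- gs]).
Proof.
rewrite mnm_sumE count_flatten -map_comp sumnE big_map.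
apply: eq_bigr => x _; rewrite /choice_mon /term_mon !mnmDE !scale_monE !pmonE.
rewrite !form_scale_eq !scale_var_eq /low_ends /=; case: (low (arc1 x.1)); case: (low (arc2 x.1)) => /=; lia.
Qed.

Lemma choice_mon_form gs (e : bool) k p :
  (\sum_(x <- gs) choice_mon x.1 x.2)%MM (enum_rank (form_var e k p)) =
  count_mem (k, p)
    [seq (y.1, if e then y.2.1 else y.2.2) | y <- [seq oriented x | x <- gs]].
Proof.
rewrite mnm_sumE -map_comp count_map -size_filter -sum1_size big_filter [RHS]big_mkcond /=.
apply: eq_bigr => x _; rewrite /choice_mon /term_mon !mnmDE !scale_monE !pmonE.
rewrite !scale_form_eq !form_var_eq !andbF.
by case: e => /=; case: ((_, _) == _).
Qed.

Definition form_weight (s : seq 'I_(nvar n)) : nat :=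
  (\sum_(z <- s) proj (arc1 z) * proj (arc2 z))%N.

Definition low_weight (s : seq 'I_(nvar n)) : nat :=
  (\sum_(z <- s | low (arc1 z)) arc1 z * arc2 z)%N.

(* The index ranges of the summands are juxtaposed, so that sorting the spread
   pairs amounts to sorting the arcs within each summand. *)
Definition spread (y : 'I_r.+1 * ('I_n * 'I_n)) : nat * nat :=
  (y.1 * n + y.2.1, y.1 * n + y.2.2)%N.

Lemma spread_coord_inj (k k' : 'I_r.+1) (p p' : 'I_n) :
  (k * n + p = k' * n + p')%N -> k = k' /\ p = p'.
Proof.
have n_gt0 : (0 < n)%N by apply: leq_ltn_trans (ltn_ord p).
move=> E; have := congr1 (divn^~ n) E; have := congr1 (modn^~ n) E.
rewrite !modnMDl !divnMDl // !divn_small ?ltn_ord // !addn0 !modn_small ?ltn_ord //.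
by move=> /val_inj -> /val_inj ->.
Qed.

Lemma spread_inj : injective spread.
Proof.
move=> [k [p q]] [k' [p' q']] [/spread_coord_inj[-> ->] /spread_coord_inj[_ ->]].
by [].
Qed.

(** Multiplying out the spread products, all contributions other than that of the product of the two
    indices depend only on the two fixed multisets. The identity is a difference written without
    subtraction. *)
Lemma pairing_weight_spread (T T0 : seq ('I_r.+1 * ('I_n * 'I_n))) :
  perm_eq [seq (y.1, y.2.1) | y <- T] [seq (y.1, y.2.1) | y <- T0] ->
  perm_eq [seq (y.1, y.2.2) | y <- T] [seq (y.1, y.2.2) | y <- T0] ->
  (pairing_weight (map spread T) + \sum_(y <- T0) y.2.1 * y.2.2 =
   pairing_weight (map spread T0) + \sum_(y <- T) y.2.1 * y.2.2)%N.
Proof.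
have split_w L : pairing_weight (map spread L) =
    (\sum_(x <- [seq (y.1, y.2.1) | y <- L])
        (x.1 * n * (x.1 * n) + x.1 * n * x.2) +
     \sum_(x <- [seq (y.1, y.2.2) | y <- L]) x.1 * n * x.2 +
     \sum_(y <- L) y.2.1 * y.2.2)%N.
  rewrite /pairing_weight !big_map -!big_split /=.
  by apply: eq_bigr => y _; rewrite mulnDl !mulnDr; lia.
by move=> e1 e2; rewrite !split_w (perm_big _ e1) (perm_big _ e2) /=; lia.
Qed.

Lemma proj_le (i j : 'I_n) : (i <= j)%N -> (proj i <= proj j)%N.
Proof.
rewrite /proj /low /lab => ij; case: ifP => hi; case: ifP => hj //; rewrite i0E; lia.
Qed.

(** The class depends only on the projected ends, so recovering the projected arc also recovers its
    class. *)
Definition arc_class (kap : 'I_n -> 'I_n -> 'I_r.+1) (z : 'I_(nvar n)) : 'I_r.+1 :=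
  kap (proj (arc1 z)) (proj (arc2 z)).

(* The arcs of [s] are distributed over the r.+1 rank 2 summands by [kap]. *)
Record separation (s : seq 'I_(nvar n)) (kap : 'I_n -> 'I_n -> 'I_r.+1) : Prop :=
  Separation {
    sep_high : forall z, z \in s -> ~~ low (arc2 z);
    sep_low : forall z z', z \in s -> z' \in s -> low (arc1 z) -> low (arc1 z') ->
      (arc1 z < arc1 z')%N -> (arc2 z <= arc2 z')%N;
    sep_class : forall z z', z \in s -> z' \in s -> arc_class kap z = arc_class kap z' ->
      (proj (arc1 z) < proj (arc1 z'))%N -> (proj (arc2 z) <= proj (arc2 z'))%N;
    sep_allowed : forall z, z \in s -> allowed (arc_class kap z) (proj (arc2 z))
  }.

Definition separated_mon (kap : 'I_n -> 'I_n -> 'I_r.+1) (s : seq 'I_(nvar n)) :=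
  (\sum_(z <- s) choice_mon z (arc_class kap z, true))%MM.

(** * Comparison of two monomials whose images share a term *)

Section Rearranged.
Variables (kap : 'I_n -> 'I_n -> 'I_r.+1) (s s' : seq 'I_(nvar n)).
Variable gs : seq ('I_(nvar n) * ('I_r.+1 * bool)).
Hypothesis sep : separation s kap.
Notation class := (arc_class kap).
Let high2 := sep_high sep.
Let low_sorted := sep_low sep.
Let class_sorted := sep_class sep.
Hypothesis gsE : unzip1 gs = s'.
Hypothesis same_mon : (\sum_(x <- gs) choice_mon x.1 x.2)%MM =
  separated_mon kap s.

Let gs0 := [seq (z, (class z, true)) | z <- s].
Let T := [seq oriented x | x <- gs].
Let T0 := [seq oriented x | x <- gs0].

Let same_mon0 : (\sum_(x <- gs) choice_mon x.1 x.2)%MM =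
  (\sum_(x <- gs0) choice_mon x.1 x.2)%MM.
Proof. by rewrite same_mon big_map. Qed.

Let perm1 : perm_eq [seq (y.1, y.2.1) | y <- T] [seq (y.1, y.2.1) | y <- T0].
Proof.
apply: perm_eq_count => -[k p].
by rewrite -!(choice_mon_form _ true) same_mon0.
Qed.

Let perm2 : perm_eq [seq (y.1, y.2.2) | y <- T] [seq (y.1, y.2.2) | y <- T0].
Proof.
apply: perm_eq_count => -[k p].
by rewrite -!(choice_mon_form _ false) same_mon0.
Qed.

Let sumT : (\sum_(y <- T) y.2.1 * y.2.2)%N = form_weight s'.
Proof.
rewrite /form_weight -gsE !big_map; apply: eq_bigr => x _.
by rewrite /oriented /=; case: ifP; rewrite // mulnC.
Qed.

Let sumT0 : (\sum_(y <- T0) y.2.1 * y.2.2)%N = form_weight s.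
Proof. by rewrite /form_weight !big_map. Qed.

Let map_spread1 L : unzip1 (map spread L) =
  [seq (x.1 * n + x.2)%N | x : 'I_r.+1 * 'I_n <- [seq (y.1, y.2.1) | y <- L]].
Proof. by rewrite /unzip1 -!map_comp. Qed.

Let map_spread2 L : unzip2 (map spread L) =
  [seq (x.1 * n + x.2)%N | x : 'I_r.+1 * 'I_n <- [seq (y.1, y.2.2) | y <- L]].
Proof. by rewrite /unzip2 -!map_comp. Qed.

Let spread_sorted : sorted_pairing (map spread T0).
Proof.
move=> _ _ /mapP[_ /mapP[_ /mapP[z zs ->] ->] ->] /mapP[_ /mapP[_ /mapP[z' zs' ->] ->] ->].
rewrite /spread /oriented /=.
have [/val_inj E|ne] := eqVneq (class z : nat) (class z').
  by rewrite E ltn_add2l leq_add2l; apply: class_sorted.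
have := ltn_ord (proj (arc1 z')); have := ltn_ord (proj (arc1 z)).
have := ltn_ord (proj (arc2 z)).
move: ne; rewrite neq_ltn => /orP[lt|lt].
  have : ((class z).+1 * n <= class z' * n)%N by rewrite leq_mul2r lt orbT.
  rewrite mulSn; lia.
have : ((class z').+1 * n <= class z * n)%N by rewrite leq_mul2r lt orbT.
rewrite mulSn; lia.
Qed.

Let weight_T : (pairing_weight (map spread T) <= pairing_weight (map spread T0)
  ?= iff perm_eq (map spread T) (map spread T0))%N.
Proof.
by apply: rearrangement => //; rewrite ?map_spread1 ?map_spread2; apply: perm_map.
Qed.

Lemma form_weight_le : (form_weight s' <= form_weight s)%N.
Proof.
have := pairing_weight_spread perm1 perm2; rewrite sumT sumT0.
have [+ _] := weight_T; lia.
Qed.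

Section FormEq.
Hypothesis weight_eq : form_weight s' = form_weight s.

Let perm_T : perm_eq T T0.
Proof.
apply: (perm_map_inj spread_inj); rewrite -(geq_leqif weight_T).
have := pairing_weight_spread perm1 perm2; rewrite sumT sumT0 weight_eq; lia.
Qed.

Let proj_arc_lt z : z \in s -> (proj (arc1 z) < proj (arc2 z))%N.
Proof.
move=> /high2; have := arc_lt z; rewrite /proj => lt12 /negPf h2; rewrite h2.
by case: ifP => // l1; rewrite i0E; apply: leq_ltn_trans lt12.
Qed.

(** Equality in the rearrangement inequality identifies the oriented arcs of gs with those of s. The
    latter strictly increase after projection, which rules out the negative term; the class is then
    read off from the projected arc. *)
Lemma choice_forced x : x \in gs -> x.2 = (class x.1, true).
Proof.
move=> xgs; have : oriented x \in T0 by rewrite -(perm_mem perm_T) map_f.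
case/mapP=> _ /mapP[z zs ->]; rewrite /oriented /=.
have := proj_arc_lt zs; have := proj_le (ltnW (arc_lt x.1)).
case: x {xgs} => [z' [k []]] /= le_z' lt_z [-> E1 E2]; first by rewrite /arc_class E1 E2.
by rewrite -E1 -E2 ltnNge le_z' in lt_z.
Qed.

Let perm_proj : perm_eq [seq (proj (arc1 z), proj (arc2 z)) | z <- s']
                        [seq (proj (arc1 z), proj (arc2 z)) | z <- s].
Proof.
have := perm_map snd perm_T; rewrite -gsE /T /T0 /gs0 -!map_comp.
congr (perm_eq _ _); apply/eq_in_map => x xgs /=.
by rewrite (choice_forced xgs).
Qed.

Let high2' z : z \in s' -> ~~ low (arc2 z).
Proof.
move=> zs'; have : (proj (arc1 z), proj (arc2 z)) \in
    [seq (proj (arc1 z), proj (arc2 z)) | z <- s].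
  by rewrite -(perm_mem perm_proj) (map_f (fun z => (proj (arc1 z), proj (arc2 z)))).
case/mapP=> z0 /proj_arc_lt + [E1 E2]; rewrite -E1 -E2 => lt.
by apply/negP => l2; move: lt; rewrite [in X in (_ < X)%N]/proj l2 i0E.
Qed.

Let low_arcs (l : seq 'I_(nvar n)) : seq (nat * nat) :=
  [seq (arc1 z : nat, arc2 z : nat) | z <- l & low (arc1 z)].

Let low_ends_high l : (forall z, z \in l -> ~~ low (arc2 z)) ->
  flatten [seq low_ends z | z <- l] = [seq arc1 z | z <- l & low (arc1 z)].
Proof.
elim: l => //= z l IH h; rewrite IH => [|y yl]; last by rewrite h // inE yl orbT.
by rewrite /low_ends /= (negPf (h z (mem_head _ _))); case: ifP.
Qed.

Let low_proj i : low i = (proj i == i0).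
Proof.
rewrite /proj; case: ifP => [_|/negbT]; first by rewrite eqxx.
rewrite /low /lab -(inj_eq val_inj) /= i0E; lia.
Qed.

Let perm_low1 : perm_eq (unzip1 (low_arcs s')) (unzip1 (low_arcs s)).
Proof.
have unzipE l : unzip1 (low_arcs l) = map val [seq arc1 z | z <- l & low (arc1 z)].
  by rewrite /unzip1 -!map_comp.
rewrite !unzipE -(low_ends_high high2) -(low_ends_high high2').
apply/perm_map/perm_eq_count => i.
have mapE (l : seq ('I_(nvar n) * ('I_r.+1 * bool))) :
    [seq low_ends x.1 | x <- l] = [seq low_ends z | z <- unzip1 l].
  by rewrite /unzip1 -map_comp.
have gs0E : unzip1 gs0 = s by rewrite /unzip1 /gs0 -map_comp map_id.
have := choice_mon_scale gs i; rewrite same_mon0 choice_mon_scale.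
by rewrite !mapE gsE gs0E => ->.
Qed.

(** Arcs with a low left end are those whose projected left end is [i0], and projection does not
    move their high right ends. *)
Let perm_low2 : perm_eq (unzip2 (low_arcs s')) (unzip2 (low_arcs s)).
Proof.
have unzipE (l : seq 'I_(nvar n)) : (forall z, z \in l -> ~~ low (arc2 z)) ->
    unzip2 (low_arcs l) = [seq (x.2 : nat) |
      x : 'I_n * 'I_n <- [seq (proj (arc1 z), proj (arc2 z)) | z <- l] & x.1 == i0].
  move=> h; rewrite /unzip2 /low_arcs filter_map -!map_comp.
  rewrite (eq_filter (a2 := fun z => low (arc1 z))); last by move=> z; rewrite /= -low_proj.
  apply/eq_in_map => z; rewrite mem_filter => /andP[_ /h /negPf h2].
  by rewrite /= /proj h2.
by rewrite (unzipE _ high2) (unzipE _ high2'); apply/perm_map/perm_filter.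
Qed.

Let low_arcs_sorted : sorted_pairing (low_arcs s).
Proof.
move=> _ _ /mapP[z + ->] /mapP[z' + ->] /=; rewrite !mem_filter.
by move=> /andP[l zs] /andP[l' zs']; apply: low_sorted.
Qed.

Let low_rearrangement : (low_weight s' <= low_weight s ?= iff
  perm_eq (low_arcs s') (low_arcs s))%N.
Proof.
have weightE l : low_weight l = pairing_weight (low_arcs l).
  by rewrite /low_weight /pairing_weight big_map big_filter.
by rewrite !weightE; apply: rearrangement.
Qed.

Lemma low_weight_le : (low_weight s' <= low_weight s)%N.
Proof. exact: low_rearrangement. Qed.

(** Arcs with a low left end agree by the equality case of the second rearrangement. On the others
    projection changes nothing, so [perm_proj] already determines them. *)
Lemma perm_arcs : low_weight s' = low_weight s -> perm_eq s' s.
Proof.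
move=> /eqP; rewrite low_rearrangement => perm_low.
pose narc z := (arc1 z : nat, arc2 z : nat).
have narc_inj : injective narc.
  move=> z z' [/val_inj E1 /val_inj E2]; apply: arc_inj.
  by rewrite [LHS]surjective_pairing [RHS]surjective_pairing -/(arc1 _) -/(arc2 _) E1 E2.
have split_l l : perm_eq (map narc l)
    (low_arcs l ++ [seq narc z | z <- l & ~~ low (arc1 z)]).
  by rewrite /low_arcs -map_cat; apply: perm_map; rewrite perm_sym perm_filterC.
have highE (l : seq 'I_(nvar n)) : (forall z, z \in l -> ~~ low (arc2 z)) ->
    [seq narc z | z <- l & ~~ low (arc1 z)] = [seq (x.1 : nat, x.2 : nat) |
      x : 'I_n * 'I_n <- [seq (proj (arc1 z), proj (arc2 z)) | z <- l] & x.1 != i0].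
  move=> h; rewrite filter_map -!map_comp.
  rewrite (eq_filter (a2 := fun z => ~~ low (arc1 z))); last by move=> z; rewrite /= -low_proj.
  apply/eq_in_map => z; rewrite mem_filter => /andP[/negPf h1 /h /negPf h2].
  by rewrite /= /proj h1 h2.
apply: (perm_map_inj narc_inj).
rewrite (permPl (split_l s')) perm_sym (permPl (split_l s)).
rewrite (highE _ high2) (highE _ high2') perm_sym.
by apply: perm_cat => //; apply/perm_map/perm_filter.
Qed.

End FormEq.
End Rearranged.

(** * Survival of an extremal term under the substitution *)

Lemma mmap1_specE (m : 'X_{1..nvar n}) :
  mmap1 (fun z => spec_entry (arc1 z) (arc2 z)) m =
  \prod_(z <- mnm_seq m) \sum_c choice_coef z c *: 'X_[choice_mon z c].
Proof. by rewrite mmap1_mnm_seq; apply: eq_bigr => z _; apply: spec_entry_choice. Qed.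

(** By [choice_forced] with s' = s, only the separated choice produces this term. It takes the
    positive term of every arc, and truncation kills none of them. *)
Lemma mcoeff_spec_self m kap : separation (mnm_seq m) kap ->
  (mmap1 (fun z => spec_entry (arc1 z) (arc2 z)) m)@_(separated_mon kap (mnm_seq m)) = 1.
Proof.
move=> sep; rewrite mmap1_specE.
rewrite (@mcoeff_prod_sum_uniq _ _ _ _ _ _ _ (fun z => (arc_class kap z, true))).
  rewrite big_seq big1 // => z /(sep_allowed sep) ok.
  by rewrite /choice_coef /oriented /= ok mulr1 expr0.
by move=> gs gsE Mgs x; apply: (choice_forced sep gsE Mgs erefl).
Qed.

(** A shared term would make both weights of m' at most those of m. With the opposite inequalities
    assumed here they are equal, and [perm_arcs] gives m' = m. *)
Lemma mcoeff_spec_other m m' kap : separation (mnm_seq m) kap -> m' <> m ->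
  (form_weight (mnm_seq m) <= form_weight (mnm_seq m'))%N ->
  (form_weight (mnm_seq m) = form_weight (mnm_seq m') ->
     low_weight (mnm_seq m) <= low_weight (mnm_seq m'))%N ->
  (mmap1 (fun z => spec_entry (arc1 z) (arc2 z)) m')@_(separated_mon kap (mnm_seq m)) = 0.
Proof.
move=> sep nm le1 le2; rewrite mmap1_specE.
apply: mcoeff_prod_sum_eq0 => gs gsE Mgs; apply: nm.
have E1 : form_weight (mnm_seq m') = form_weight (mnm_seq m).
  by apply/eqP; rewrite eqn_leq le1 andbT (form_weight_le sep gsE Mgs).
have E2 : low_weight (mnm_seq m') = low_weight (mnm_seq m).
  by apply/eqP; rewrite eqn_leq le2 // andbT (low_weight_le sep gsE Mgs E1).
have /seq.permP P := perm_arcs sep gsE Mgs E1 E2.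
by apply/mnmP=> z; rewrite -!count_mnm_seq P.
Qed.

Lemma spec_neq0 (f : {mpoly K[nvar n]}) :
  f != 0 -> (forall m, m \in msupp f -> exists kap, separation (mnm_seq m) kap) ->
  spec f != 0.
Proof.
move=> f0 sep_f; have supp0 : msupp f != [::] :> seq _ by rewrite msupp_eq0.
have [m mf m_min] := lex_min (fun m => form_weight (mnm_seq m))
                             (fun m => low_weight (mnm_seq m)) supp0.
have [kap sep_m] := sep_f m mf.
apply/eqP => /(congr1 (mcoeff (separated_mon kap (mnm_seq m)))).
rewrite mcoeff0 /spec /mmap raddf_sum /= (bigD1_seq m) ?msupp_uniq //=.
rewrite big_seq_cond big1 ?addr0 => [|m' /andP[/m_min[le1 le2] /eqP ne]].
  rewrite mcoeffCM mcoeff_spec_self // mulr1 => /eqP.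
  by rewrite mcoeff_eq0 mf.
by rewrite mcoeffCM (mcoeff_spec_other sep_m) // mulr0.
Qed.

(** * Heights of arcs in standard monomials *)

Definition gen_mon (t : nat) (m : 'X_{1..nvar n}) : Prop :=
  [\/ exists i j : 'I_n, [/\ (i < j)%N, regA a (i, j) & m = xmon i j],
      adiag 2 (fun p => [|| regA a p, regB a b p | regC a b p]) m,
      adiag t (fun p => [|| regA a p, regB a b p | regD a b p]) m
    | adiag t.+1 predT m].

Definition nested (x y : 'I_(nvar n)) : bool :=
  (arc1 x < arc1 y)%N && (arc2 y < arc2 x)%N.

Lemma nested_trans : transitive nested.
Proof. by move=> y x z /andP[a1 a2] /andP[b1 b2]; apply/andP; split; lia. Qed.

Lemma xmon_arc z : xmon (arc1 z) (arc2 z) = U_(z)%MM.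
Proof.
have [z' -> z'E] := xmonE (arc_lt z); congr (U_(_))%MM.
by apply: arc_inj; rewrite z'E -surjective_pairing.
Qed.

(** Every left end precedes every right end: for two arcs of the chain, compare through the inner
    one, whose own ends are in order. *)
Lemma nested_sorted c : sorted nested c ->
  sorted ltn [seq lab k | k <- [seq arc1 z | z <- c] ++ rev [seq arc2 z | z <- c]].
Proof.
move=> sort_c; rewrite map_cat map_rev -!map_comp sorted_pairwise; last exact: ltn_trans.
rewrite pairwise_cat -!sorted_pairwise; try exact: ltn_trans.
rewrite rev_sorted !sorted_map; apply/and3P; split.
- rewrite allrel_revr allrel_mapl allrel_mapr; apply/allrelP => x y.
  move=> /(nthP x)[i lt_i <-] /(nthP x)[j lt_j <-] /=.
  have nest_nth := sorted_ltn_nth nested_trans x sort_c.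
  have := arc_lt (nth x c i); have := arc_lt (nth x c j); rewrite /lab.
  case: (ltngtP i j) => [lt_ij|lt_ji|->] //.
    by have /andP[a1 _] := nest_nth i j lt_i lt_j lt_ij => b1 _; exact: ltn_trans a1 b1.
  by have /andP[_ a2] := nest_nth j i lt_j lt_i lt_ji => _ b2; exact: ltn_trans b2 a2.
- by apply: sub_sorted sort_c => x y /andP[].
- by apply: sub_sorted sort_c => x y /andP[].
Qed.

(** Strictly nested arcs are distinct, so their product is squarefree and divides every monomial
    that involves each of them. *)
Lemma nested_adiag c (m : 'X_{1..nvar n}) (reg : pred ('I_n * 'I_n)) :
  sorted nested c -> {subset c <= mnm_seq m} ->
  (forall z, z \in c -> reg (arc1 z, arc2 z)) ->
  exists2 g, adiag (size c) reg g & (g <= m)%MM.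
Proof.
move=> sort_c sub_c reg_c; exists (\sum_(z <- c) U_(z))%MM.
  exists (map_tuple arc1 (in_tuple c)), (map_tuple arc2 (in_tuple c)); split.
  - exact: nested_sorted.
  - by move=> k; rewrite !tnth_map; apply: reg_c; apply: mem_tnth.
  - by rewrite big_tnth; apply: eq_bigr => k _; rewrite !tnth_map xmon_arc.
apply/mnm_lepP => z; rewrite mnm_sumE.
under eq_bigr do rewrite mnm1E.
have uniq_c : uniq c.
  by apply: sorted_uniq sort_c; [exact: nested_trans | move=> x; rewrite /nested ltnn].
have -> : (\sum_(z' <- c) (z' == z))%N = count_mem z c.
  by rewrite -sum1_count [RHS]big_mkcond.
by rewrite count_uniq_mem //; case: (boolP (z \in c)) => // /sub_c; rewrite mem_mnm_seq.
Qed.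

Lemma proj_lt (i j : 'I_n) : (proj i < proj j)%N -> (i < j)%N.
Proof. by rewrite ltnNge => lt; rewrite ltnNge; apply: contra lt; apply: proj_le. Qed.

Section Heights.
Variables (m : 'X_{1..nvar n}).
Hypothesis std_m : forall g, gen_mon r.+1 g -> ~ (g <= m)%MM.
Let s := mnm_seq m.
Let inner (x y : nat * nat) : bool := (x.1 < y.1)%N && (y.2 < x.2)%N.
(** Right ends are high in m, so this is the projected arc on which a class may depend. Two arcs
    with low left ends share the first coordinate and are never [inner] to one another. *)
Let ends (z : 'I_(nvar n)) : nat * nat := (proj (arc1 z) : nat, arc2 z : nat).

(* Length of the longest chain of arcs of [m] nested inside [x]; chains have
   length at most [k] as soon as [x.2 <= k]. *)
Fixpoint height (k : nat) (x : nat * nat) : nat :=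
  if k is k'.+1 then \max_(z <- s | inner x (ends z)) (height k' (ends z)).+1 else 0%N.

Lemma height_fuel k k' x : (x.2 <= k)%N -> (x.2 <= k')%N -> height k x = height k' x.
Proof.
elim: k k' x => [|k IH] [|k'] x //= le_k le_k'.
- by rewrite big_pred0 // => z; rewrite /inner; lia.
- by rewrite big_pred0 // => z; rewrite /inner; lia.
apply: eq_bigr => z /andP[_ lt]; congr _.+1; apply: IH; lia.
Qed.

Lemma height_inner z z' : z' \in s -> inner (ends z) (ends z') ->
  (height n (ends z') < height n (ends z))%N.
Proof.
move=> zs' in_z; rewrite (@height_fuel n n.+1 (ends z)).
- by apply: (bigmaxn_sup_seq z').
- exact: ltnW (ltn_ord _).
- exact/ltnW/ltnW/ltn_ord.
Qed.

Lemma height_chain k x l : (l <= height k x)%N -> exists c : seq 'I_(nvar n),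
  [/\ size c = l, {subset c <= s} & path inner x (map ends c)].
Proof.
elim: k x l => [|k IH] x [|l] le_l; try by exists [::].
have [z zs /andP[in_z le_z]] : exists2 z, z \in s & inner x (ends z) && (l <= height k (ends z))%N.
  apply: NNPP => H; move: le_l; rewrite ltnNge => /negP; apply.
  apply/bigmax_leqP_seq => z zs in_z; rewrite ltnNge; apply/negP => le_z.
  by apply: H; exists z; rewrite ?in_z.
have [c [size_c sub_c path_c]] := IH _ _ le_z.
exists (z :: c); split=> /=; rewrite ?size_c ?in_z //.
by move=> y; rewrite inE => /predU1P[->//|/sub_c].
Qed.

Lemma high_arc2 z : z \in s -> ~~ low (arc2 z).
Proof.
move=> zs; apply/negP => l2; apply: (@std_m (xmon (arc1 z) (arc2 z))).
  by constructor 1; exists (arc1 z), (arc2 z); split=> //; apply: arc_lt.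
rewrite xmon_arc; apply/mnm_lepP => y; rewrite mnm1E; case: eqP => // <-.
by rewrite -mem_mnm_seq.
Qed.

Lemma height_sorted z l : z \in s -> (l <= height n (ends z))%N ->
  exists c : seq 'I_(nvar n),
  [/\ size c = l, {subset z :: c <= s} & sorted nested (z :: c)].
Proof.
move=> zs /height_chain[c [size_c sub_c path_c]]; exists c; split=> //.
  by move=> y; rewrite inE => /predU1P[->//|/sub_c].
move: path_c; rewrite path_map /=; apply: sub_path => x y /andP[/= lt1 lt2].
by rewrite /nested lt2 proj_lt.
Qed.

(** Together with z, a chain of t arcs inside z would form a (t+1)-adiag. *)
Lemma height_lt z : z \in s -> (height n (ends z) < r.+1)%N.
Proof.
move=> zs; rewrite ltnNge; apply/negP => /(height_sorted zs)[c [size_c sub_c sort_c]].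
have [g g_adiag] := @nested_adiag _ m predT sort_c sub_c (fun _ _ => isT).
by apply: std_m; constructor 4; rewrite /= size_c in g_adiag.
Qed.

(** All arcs nested in z also end before b, hence lie in the union of A, B and D; z together with
    t-1 of them would be a forbidden t-adiag. *)
Lemma height_lt_b z : z \in s -> (lab (arc2 z) < b)%N -> (height n (ends z) < r)%N.
Proof.
move=> zs lt_b; rewrite ltnNge; apply/negP => /(height_sorted zs)[c [size_c sub_c sort_c]].
have [|g g_adiag] := @nested_adiag _ m (fun p => [|| regA a p, regB a b p | regD a b p]) sort_c sub_c.
  move=> y yc; have le_y : (arc2 y <= arc2 z)%N.
    move: yc; rewrite inE => /predU1P[->//|yc].
    have := sort_c; rewrite /= path_sortedE; last exact: nested_trans.
    by case/andP=> /allP/(_ y yc)/andP[_ /ltnW].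
  move: lt_b; rewrite /regA /regB /regD /lab /=; lia.
by apply: std_m; constructor 3; rewrite /= size_c in g_adiag.
Qed.

(** The class is the height. The four conditions come, in order, from (i), from (ii), from the fact
    that nesting changes the height, and from (iii) through [height_lt_b]. *)
Lemma separation_std : exists kap, separation s kap.
Proof.
(* The default value of [inord] is never reached on arcs of m, by [height_lt], which rests on
   (iv). *)
pose kap (p q : 'I_n) : 'I_r.+1 := inord (height n (p : nat, q : nat)).
have projE z : z \in s -> proj (arc2 z) = arc2 z.
  by move=> /high_arc2/negPf h2; rewrite /proj h2.
have kapE z : z \in s -> arc_class kap z = height n (ends z) :> nat.
  by move=> zs; rewrite /arc_class /kap inordK projE // height_lt.
exists kap; split=> [z zs|z z' zs zs' l1 l1' lt1|z z' zs zs' E lt1|z zs].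
- exact: high_arc2.
- rewrite leqNgt; apply/negP => lt2.
  have [|||g g_adiag] := @nested_adiag [:: z; z'] m
    (fun p => [|| regA a p, regB a b p | regC a b p]).
  + by rewrite /= /nested lt1 lt2.
  + by move=> y; rewrite !inE => /orP[]/eqP->.
  + move=> y; rewrite !inE => H; have : low (arc1 y) by case/orP: H => /eqP->.
    rewrite /low /regA /regB /regC /lab /=; lia.
  by apply: std_m; constructor 2.
- rewrite !projE // leqNgt; apply/negP => lt2.
  have := @height_inner z z' zs'; rewrite /inner /= lt1 lt2 -!kapE // E ltnn.
  by move=> /(_ isT).
rewrite /allowed; apply/implyP => /eqP/(congr1 val); rewrite /= kapE // projE // => E.
by rewrite leqNgt; apply/negP => /(height_lt_b zs); rewrite E ltnn.
Qed.
End Heights.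

End Specialization.

(** * The generators as leading monomials *)

Lemma dhomog_prod_ord (R : comNzRingType) N t (F : 'I_t -> {mpoly R[N]}) :
  (forall i, F i \is 1.-homog) -> \prod_i F i \is t.-homog.
Proof.
elim: t F => [|t IH] F hF; first by rewrite big_ord0 dhomog1.
rewrite big_ord_recl; apply: (@dhomogM _ _ _ 1%N _ t); first exact: hF.
by apply: IH => i; apply: hF.
Qed.

Lemma genX_homog (K : fieldType) n i j : genX K n i j \is 1.-homog.
Proof.
have xmon_homog (p q : 'I_n) : (p < q)%N ->
    'X_[K, xmon p q] \is 1.-homog.
  by move=> /xmonE[z -> _]; rewrite dhomogX /= mdeg1.
rewrite mxE; case: ltngtP => [|ji|_]; [exact: xmon_homog| |exact: dhomog0].
by rewrite rpredN xmon_homog.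
Qed.

Lemma pfpoly_homog (K : fieldType) n (u : pfidx n) :
  pfpoly K u \is (half_size u).-homog.
Proof.
rewrite /pfpoly /pfaffian rpred_sum // => s _.
rewrite mulr_sign; case: ifP => _; rewrite ?rpredN dhomog_prod_ord // => i;
  by rewrite mxE genX_homog.
Qed.

Lemma rev_index s k : (k < s)%N ->
  [/\ k < s.*2 - k.+1, s.*2 - k.+1 < s.*2, k < s.*2, (s.*2 - k.+1 < s) = false
    & s - (s.*2 - k.+1 - s).+1 = k]%N.
Proof. by move=> lt_k; split; lia. Qed.

(** The increasing list i_1, ..., i_s, j_s, ..., j_1 is itself a Pfaffian index; its position k is
    mirrored by position 2s-1-k, so the antidiagonal pairs i_k with j_k. *)
Lemma adiag_pfidx n s reg (m : 'X_{1..nvar n}) : adiag s reg m ->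
  exists (u : pfidx n) (i j : s.-tuple 'I_n),
  [/\ half_size u = s, antidiag_mon u = m,
      forall k : 'I_s, nth 0%N (pflabels u) k = lab (tnth i k) /\
        nth 0%N (pflabels u) (s.*2 - k.+1) = lab (tnth j k),
      forall k, (tnth i k < tnth j k)%N & forall k, reg (tnth i k, tnth j k)].
Proof.
move=> [i [j [sort_ij reg_ij mE]]].
have sort_rows : sorted ltn [seq lab k | k <- tcast (addnn s) (cat_tuple i (rev_tuple j))].
  by rewrite val_tcast.
have size_ij : size (i ++ rev j) = s.*2.
  by rewrite size_cat size_rev !size_tuple addnn.
have nth_i x0 (k : 'I_s) : nth x0 (i ++ rev j) k = tnth i k.
  by rewrite nth_cat size_tuple ltn_ord -tnth_nth.
have nth_j x0 (k : 'I_s) : nth x0 (i ++ rev j) (s.*2 - k.+1) = tnth j k.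
  have [_ lt2 _ ge_s eq_k] := rev_index (ltn_ord k).
  rewrite nth_cat size_tuple ge_s nth_rev size_tuple; last first.
    by rewrite ltn_subLR ?addnn // leqNgt ge_s.
  by rewrite eq_k -tnth_nth.
exists (PfIdx sort_rows), i, j; split=> //.
- rewrite mE /antidiag_mon /=; apply: eq_bigr => k _.
  have x0 : 'I_n := tnth i k.
  by rewrite !(tnth_nth x0) /= val_tcast /= !(nth_j x0) (nth_i x0) !(tnth_nth x0).
- move=> k; rewrite /pflabels /= val_tcast; have x0 : 'I_n := tnth i k.
  have [_ lt2 lt3 _ _] := rev_index (ltn_ord k).
  by rewrite !(nth_map x0) /= ?size_ij // nth_i nth_j.
move=> k; have [lt1 lt2 lt3 _ _] := rev_index (ltn_ord k).
have := sorted_ltn_nth ltn_trans 0%N sort_ij k (s.*2 - k.+1)%N.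
rewrite !inE size_map size_ij lt2 lt3 => /(_ isT isT lt1).
have x0 : 'I_n := tnth i k.
by rewrite !(nth_map x0) ?size_ij // nth_i nth_j.
Qed.

(** The comparison with alpha fails, with positions counted from 0, at position 1 in case (i)
    through j, at position 1 in case (ii) through i_2, at position 2t-1 in case (iii) through j_1,
    and by size in case (iv). *)
Lemma gen_mon_pfidx n t a b (alpha : pfidx n) (m : 'X_{1..nvar n}) :
  (2 <= t)%N -> (2 <= a)%N -> (a + 2 * t - 3 < b)%N ->
  pflabels alpha = 1%N :: rcons (iota a (2 * t - 2)) b ->
  gen_mon a b t m -> exists2 u : pfidx n, ~ pfle alpha u & antidiag_mon u = m.
Proof.
move=> t_ge2 a_ge2 lt_b alphaE.
have half_alpha : half_size alpha = t.
  have := congr1 size alphaE; rewrite size_map size_tuple /= size_rcons size_iota; lia.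
have alpha1 : nth 0%N (pflabels alpha) 1 = a.
  have pos : (0 < 2 * t - 2)%N by lia.
  by rewrite alphaE /= nth_rcons size_iota pos nth_iota ?addn0.
have alpha_last : nth 0%N (pflabels alpha) (2 * t - 1) = b.
  rewrite alphaE (_ : (2 * t - 1 = (2 * t - 2).+1)%N) /=; last lia.
  by rewrite nth_rcons size_iota ltnn eqxx.
case=> [[i [j [ij reg_ij ->]]]|/adiag_pfidx|/adiag_pfidx|/adiag_pfidx].
- have [|u [i' [j' [half_u uE lab_u _ reg_u]]]] :=
    @adiag_pfidx n 1 (fun p => regA a p) (xmon i j).
    exists [tuple i], [tuple j]; split=> [|k|]; rewrite /= ?ltnS ?ij //.
      by rewrite ord1.
    by rewrite big_ord1.
  exists u => // -[_]; rewrite half_u => /(_ 1%N isT); rewrite alpha1.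
  have [_ ->] := lab_u ord0; have := reg_u ord0; rewrite /regA /lab /=; lia.
- move=> [u [i [j [half_u uE lab_u ij reg_u]]]]; exists u => // -[_].
  rewrite half_u => /(_ 1%N isT); rewrite alpha1.
  have [-> _] := lab_u ord_max.
  have := ij ord_max; have := reg_u ord_max.
  rewrite /regA /regB /regC /lab /=; lia.
- move=> [u [i [j [half_u uE lab_u ij reg_u]]]]; exists u => // -[_].
  rewrite half_u => /(_ (2 * t - 1)%N); rewrite alpha_last.
  (* Index of the outermost arc, whose right end is the last label of u. *)
  pose k0 := Ordinal (ltnW t_ge2).
  have [_] := lab_u k0; rewrite -mul2n => -> le_b.
  have := le_b _; have := reg_u k0; rewrite /regA /regB /regD /=; lia.
- move=> [u [i [j [half_u uE lab_u ij reg_u]]]]; exists u => // -[].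
  by rewrite half_u half_alpha ltnn.
Qed.

Theorem proposition3p3 (K : fieldType) (n t a b : nat)
    (le : rel 'X_{1..nvar n}) (alpha : pfidx n) :
  (2 <= t)%N -> (2 <= a)%N -> (a + 2 * t - 3 < b)%N -> (b <= n)%N ->
  term_order le -> antidiagonal K le ->
  (* iota a (2t-2) is a, a+1, ..., a+2t-3 *)
  pflabels alpha = 1%N :: rcons (iota a (2 * t - 2)) b ->
  forall f : {mpoly K[nvar n]},
    initial_ideal le (cogen_ideal alpha) f <->
    ideal_gen (fun g => exists m : 'X_{1..nvar n}, g = 'X_[m] /\
      [\/ exists i j : 'I_n, [/\ (i < j)%N, regA a (i, j) & m = xmon i j],
          adiag 2 (fun p => [|| regA a p, regB a b p | regC a b p]) m,
          adiag t (fun p => [|| regA a p, regB a b p | regD a b p]) m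
        | adiag t.+1 predT m]) f.
Proof.
move=> t_ge2 a_ge2 lt_b le_bn le_order antidiag alphaE f.
have gen_u m : gen_mon a b t m ->
    exists2 u : pfidx n, cogen_ideal alpha (pfpoly K u) & antidiag_mon u = m.
  move=> /(gen_mon_pfidx t_ge2 a_ge2 lt_b alphaE)[u nle uE]; exists u => //.
  by apply: ideal_gen_mem; exists u.
split; apply: ideal_gen_sub => g; last first.
  move=> [m [-> /gen_u[u Iu <-]]]; apply: ideal_gen_mem.
  by exists (pfpoly K u), (antidiag_mon u).
move=> [h [m [Ih h_m ->]]].
(* The monomials of J: those divisible by a generator. *)
pose D (m0 : 'X_{1..nvar n}) := exists2 g, gen_mon a b t g & (g <= m0)%MM.
have [[m' gm' le_m']|nDm] := classic (D m).
  rewrite -(submK le_m') mpolyXD; apply/ideal_genM/ideal_gen_mem.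
  by exists m'.
have D_lead m' : D m' -> exists p : {mpoly K[nvar n]},
    [/\ cogen_ideal alpha p, is_initial le p m' & p \is (mdeg m').-homog].
  move=> [m0 /gen_u[u Iu uE] le_m0].
  have [u_supp u_max] := antidiag u.
  (* Shifting the Pfaffian led by the generator m0 makes m' its leading monomial, by compatibility
     of the order with products. *)
  exists ('X_[m' - m0] * pfpoly K u); split; first exact: ideal_genM.
    split=> [|x]; rewrite mulrC (perm_mem (msuppMX _ _)).
      by apply/mapP; exists m0; rewrite ?submK // -uE.
    move=> /mapP[y /u_max le_y ->]; rewrite -{2}(submK le_m0) [(_ + y)%MM]addmC [X in le _ X]addmC -uE.
    exact: (to_mul le_order).
  have deg_u : mdeg m0 = half_size u.
    by have /dhomogP/(_ _ u_supp) := pfpoly_homog K u; rewrite uE.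
  rewrite -{2}(submK le_m0) mdegD; apply: dhomogM; first by rewrite dhomogX.
  by rewrite deg_u pfpoly_homog.
have [H [IH H0 nDH]] := standard_representative le_order D_lead Ih h_m nDm.
have n_gt0 : (0 < n)%N by lia.
(* With t = [r.+1], the substitution sends H both to zero, as a member of the cogenerated ideal, and
   to a nonzero polynomial, as its support avoids J. *)
case: t => // r in t_ge2 lt_b alphaE @D nDm nDH D_lead gen_u *.
have i0E : Ordinal n_gt0 = 0%N :> nat by [].
have sep m' : m' \in msupp H ->
    exists kap, @separation n r a b (Ordinal n_gt0) (mnm_seq m') kap.
  move=> m'H; apply: separation_std => // g0 gg le_g.
  by apply: (nDH m' m'H); exists g0.
have := spec_neq0 i0E a_ge2 H0 sep.
by rewrite (spec_cogen_ideal i0E a_ge2 alphaE IH) eqxx.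
Qed.
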